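(* Let $k=-5/3$, let $W$ be the Weyl vertex algebra, and let $W=W^{(0)}\oplus W^{(1)}\oplus W^{(-1)}$ be the decomposition into eigenspaces of the order $3$ automorphism $g=e^{2\pi i J_0}$ of $W$, where $J=-\frac13a^+_{-1}a^-_{-1}\mathbf 1$ and $W^{(j)}=\{v\in W\mid gv=e^{2\pi i j/3}v\}$. Then: (1) $\mathcal W_k=W^{(0)}$. (2) $W^{(1)}$ and $W^{(-1)}$ are irreducible $\mathcal W_k$-modules of highest weight $(\frac13,\frac13)$ and $(-\frac13,\frac23)$ respectively.
   Context: For $k\in\mathbb C$, $k\ne -3$, $\mathcal W^k=\mathcal W^k(sl_3,f_\theta)$ is the universal Bershadsky-Polyakov vertex algebra of level $k$: the universal vertex algebra strongly generated by even fields $J,T,G^+,G^-$ with OPEs $J(z)J(w)\sim \frac{2k+3}{3}(z-w)^{-2}$, $G^\pm(z)G^\pm(w)\sim 0$, $J(z)G^\pm(w)\sim \pm G^\pm(w)(z-w)^{-1}$, $T(z)T(w)\sim \frac{c_k}{2}(z-w)^{-4}+2T(w)(z-w)^{-2}+DT(w)(z-w)^{-1}$, $T(z)G^\pm(w)\sim\frac32 G^\pm(w)(z-w)^{-2}+DG^\pm(w)(z-w)^{-1}$, $T(z)J(w)\sim J(w)(z-w)^{-2}+DJ(w)(z-w)^{-1}$, $G^+(z)G^-(w)\sim (k+1)(2k+3)(z-w)^{-3}+3(k+1)J(w)(z-w)^{-2}+\left(3:J(w)J(w):+\frac{3(k+1)}{2}DJ(w)-(k+3)T(w)\right)(z-w)^{-1}$,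 where $c_k=-\frac{(3k+1)(2k+3)}{k+3}$ and $D$ is the translation operator (derivative). $\mathcal W_k$ is its unique simple quotient. Modes: $T(z)=\sum L_nz^{-n-2}$, $J(z)=\sum J_nz^{-n-1}$, $G^\pm(z)=\sum G^\pm_nz^{-n-1}$. Set $J(n)=J_n$, $L(n)=L_n-\frac{n+1}{2}J_n$, $G^+(n)=G^+_n$, $G^-(n)=G^-_{n+1}$. A highest weight module of highest weight $(x,y)$ is generated by a vector $v$ with $J(0)v=xv$, $L(0)v=yv$, and $J(n)v=L(n)v=G^+(n)v=G^-(n-1)v=0$ for $n\ge1$. The Weyl vertex algebra $W$ is the universal vertex algebra generated by even fields $a^\pm(z)=\sum_{n\in\mathbb Z}a^\pm_nz^{-n-1}$ with $[a^+_r,a^-_s]=\delta_{r+s+1,0}$, $[a^\pm_r,a^\pm_s]=0$, and $a^\pm_n\mathbf 1=0$ for $n\ge 0$. For $k=-5/3$, the map $\mathcal W^k\to W$ determined by $J\mapsto-\frac13a^+_{-1}a^-_{-1}\mathbf 1$, $\omega\mapsto\frac12(a^-_{-2}a^+_{-1}-a^+_{-2}a^-_{-1})\mathbf 1$, $G^+\mapsto\frac13(a^+_{-1})^3\mathbf 1$, $G^-\mapsto\frac19(a^-_{-1})^3\mathbf 1$ (where $\omega$ is the conformal vector of $T$) is a homomorphism of vertex algebras. The statement $\mathcal W_k=W^{(0)}$ means that the image of this homomorphism is $W^{(0)}$ and is isomorphic to the simple quotient $\mathcal W_k$; the $\mathcal W_k$-module structure on $W^{(\pm1)}$ is through this identification.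 *)

(* Defs.v *)
From HB Require Import structures.
From mathcomp Require Import all_boot all_order all_algebra.
From mathcomp Require Import complex.
From mathcomp Require Import all_classical all_reals all_analysis.

Set Implicit Arguments.
Unset Strict Implicit.
Unset Printing Implicit Defensive.

Import Order.TTheory GRing.Theory Num.Theory.
Import numFieldNormedType.Exports.

Local Open Scope classical_set_scope.
Local Open Scope ring_scope.
Local Open Scope complex_scope.

Section VertexAlgebras.
Variable F : numFieldType.

Definition subspace (M : lmodType F) (P : set M) : Prop :=
  P 0 /\ forall (c : F) x y, P x -> P y -> P (c *: x + y).

Definition binz (m : int) (j : nat) : F :=
  (\prod_(i < j) (m%:~R - i%:R)) / j`!%:R.

(* The Borcherds (Jacobi) identity, with [mul a n b] = a_(n) b and
   [act a n w] = a_(n) w. Truncation makes each of the three sums over j finite,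
   so "for all large N" gives them their usual meaning. *)
Definition borcherds (V M : lmodType F) (mul : V -> int -> V -> V)
    (act : V -> int -> M -> M) : Prop :=
  forall (a b : V) (w : M) (l m n : int),
  exists N0 : nat, forall N : nat, (N0 <= N)%N ->
    \sum_(j < N) binz m j *: act (mul a (l + j%:Z) b) (m + n - j%:Z) w =
    \sum_(j < N) ((-1) ^+ j * binz l j) *:
      (act a (m + l - j%:Z) (act b (n + j%:Z) w)
       - (-1) ^ l *: act b (n + l - j%:Z) (act a (m + j%:Z) w)).

(* [vmul a n b] is the n-th product a_(n) b, that is
   a(z) b = \sum_n (a_(n) b) z^(-n-1). All vectors are even, and the zero
   algebra is excluded. *)
Record vertexAlgebra := VertexAlgebra {
  vsort :> lmodType F;
  vac : vsort;
  vmul : vsort -> int -> vsort -> vsort;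
  vac_neq0 : vac != 0;
  vmul_linearl : forall n b, linear (fun a => vmul a n b);
  vmul_linearr : forall a n, linear (vmul a n);
  vmul_trunc : forall a b, exists N : int, forall n, N <= n -> vmul a n b = 0;
  vac_vmul : forall n b, vmul vac n b = if n == -1 then b else 0;
  vmul_vac_ge0 : forall a n, 0 <= n -> vmul a n vac = 0;
  vmul_vacN1 : forall a, vmul a (-1) vac = a;
  vmul_borcherds : borcherds vmul vmul
}.

Record vmodule (V : vertexAlgebra) := VModule {
  msort :> lmodType F;
  mact : V -> int -> msort -> msort;
  mact_linearl : forall n w, linear (fun a => mact a n w);
  mact_linearr : forall a n, linear (mact a n);
  mact_trunc : forall a w, exists N : int, forall n, N <= n -> mact a n w = 0;
  vac_mact : forall n w, mact (vac V) n w = if n == -1 then w else 0;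
  mact_borcherds : borcherds (@vmul V) mact
}.

Record vhom (V U : vertexAlgebra) := VHom {
  vfun :> V -> U;
  vhom_linear : linear vfun;
  vhom_vac : vfun (vac V) = vac U;
  vhom_vmul : forall a n b, vfun (vmul a n b) = vmul (vfun a) n (vfun b)
}.

End VertexAlgebras.

Arguments vac {F V} : rename.
Arguments vmul {F V} a n b : rename.
Arguments mact {F V M} a n w : rename.

Notation "a \_( n ) b" := (vmul a n b)
  (at level 40, n at level 99, b at level 40, right associativity,
   format "a  \_( n )  b") : ring_scope.

Section Theory.
Variable F : numFieldType.
Implicit Types V U : vertexAlgebra F.

Definition vder V (a : V) : V := a \_(-2) vac.

Definition vadjoint V : vmodule V :=
  VModule (@vmul_linearl F V) (@vmul_linearr F V) (@vmul_trunc F V)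
    (@vac_vmul F V) (@vmul_borcherds F V).

Section Restriction.
Variables (V U : vertexAlgebra F) (f : vhom V U) (M : vmodule U).

Let act (a : V) (n : int) (w : M) : M := mact (f a) n w.

Fact vrestrict_linearl n w : linear (fun a => act a n w).
Proof. by move=> c a b; rewrite /act vhom_linear mact_linearl. Qed.

Fact vrestrict_linearr a n : linear (act a n).
Proof. exact: mact_linearr. Qed.

Fact vrestrict_trunc a w : exists N : int, forall n, N <= n -> act a n w = 0.
Proof. exact: mact_trunc. Qed.

Fact vrestrict_vac n w : act vac n w = if n == -1 then w else 0.
Proof. by rewrite /act vhom_vac vac_mact. Qed.

Fact vrestrict_borcherds : borcherds (@vmul F V) act.
Proof.
move=> a b w l m n; have [N0 hN0] := mact_borcherds (f a) (f b) w l m n.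
exists N0 => N /hN0 <-; apply: eq_bigr => j _.
by rewrite /act vhom_vmul.
Qed.

Definition vrestrict : vmodule V :=
  VModule vrestrict_linearl vrestrict_linearr vrestrict_trunc
    vrestrict_vac vrestrict_borcherds.

End Restriction.

Definition vautomorphism V (g : V -> V) : Prop :=
  bijective g /\ exists h : vhom V V, g = h :> (V -> V).

Definition videal V (I : set V) : Prop :=
  subspace I /\
  forall (a b : V) (n : int), I b -> I (a \_(n) b) /\ I (b \_(n) a).

Definition vsimple V : Prop :=
  forall I : set V, videal I -> I = [set 0] \/ I = setT.

Definition is_simple_quotient V U (q : vhom V U) : Prop :=
  range q = setT /\ vsimple U.

Definition vsubalgebra V (P : set V) : Prop :=
  [/\ subspace P, P vac &
      forall (a b : V) (n : int), P a -> P b -> P (a \_(n) b)].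

Definition generated V (X : set V) : Prop :=
  forall P : set V, vsubalgebra P -> X `<=` P -> P = setT.

(* V is spanned by the x1_(-n1-1) ... xr_(-nr-1) vac with all ni >= 0. *)
Definition strongly_generated V (X : set V) : Prop :=
  forall P : set V, subspace P -> P vac ->
    (forall x (n : nat) v, X x -> P v -> P (x \_(- n.+1%:Z) v)) -> P = setT.

(* a(z) b(w) ~ \sum_n cs_n (z-w)^(-n-1): the simple pole comes first. *)
Definition ope V (a b : V) (cs : seq V) : Prop :=
  forall n : nat, a \_(n%:Z) b = cs`_n.

Definition vsubmodule V (M : vmodule V) (N : set M) : Prop :=
  subspace N /\ forall (a : V) (n : int) w, N w -> N (mact a n w).

Definition virreducible V (M : vmodule V) (N : set M) : Prop :=
  [/\ vsubmodule N, N <> [set 0] &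
      forall N' : set M, vsubmodule N' -> N' `<=` N ->
        N' = [set 0] \/ N' = N].

(* Bershadsky-Polyakov algebra *)

Record bp_fields (V : Type) := BPFields { bpJ : V; bpT : V; bpGp : V; bpGm : V }.

Definition bp_map (V U : Type) (f : V -> U) (x : bp_fields V) : bp_fields U :=
  BPFields (f (bpJ x)) (f (bpT x)) (f (bpGp x)) (f (bpGm x)).

Definition bp_charge (k : F) : F := - ((3 * k + 1) * (2 * k + 3) / (k + 3)).

Definition bp_relations (k : F) V (x : bp_fields V) : Prop :=
  let: BPFields J T Gp Gm := x in
  [/\ ope J J [:: 0; ((2 * k + 3) / 3) *: vac],
      ope Gp Gp [::] /\ ope Gm Gm [::],
      ope J Gp [:: Gp] /\ ope J Gm [:: - Gm]
    & [/\ ope T T [:: vder T; 2 *: T; 0; (bp_charge k / 2) *: vac],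
          ope T Gp [:: vder Gp; (3 / 2) *: Gp]
            /\ ope T Gm [:: vder Gm; (3 / 2) *: Gm],
          ope T J [:: vder J; J]
        & ope Gp Gm
            [:: 3 *: (J \_(-1) J) + (3 * (k + 1) / 2) *: vder J - (k + 3) *: T;
                (3 * (k + 1)) *: J;
                ((k + 1) * (2 * k + 3)) *: vac]]].

Definition is_universal_BP (k : F) V (x : bp_fields V) : Prop :=
  [/\ bp_relations k x,
      strongly_generated [set y | [\/ y = bpJ x, y = bpT x, y = bpGp x | y = bpGm x]]
    & forall U (y : bp_fields U), bp_relations k y ->
        exists f : vhom V U, bp_map f x = y].

Section HighestWeight.
Variables (V : vertexAlgebra F) (x : bp_fields V) (M : vmodule V).

(* T(z) = \sum_n L_n z^(-n-2), hence L_n = T_(n+1); all the other fields are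
   expanded in z^(-n-1). *)
Definition bpJn (n : int) (w : M) : M := mact (bpJ x) n w.
Definition bpLn (n : int) (w : M) : M :=
  mact (bpT x) (n + 1) w - ((n + 1)%:~R / 2) *: mact (bpJ x) n w.
Definition bpGpn (n : int) (w : M) : M := mact (bpGp x) n w.
Definition bpGmn (n : int) (w : M) : M := mact (bpGm x) (n + 1) w.

Definition highest_weight (N : set M) (h y : F) : Prop :=
  vsubmodule N /\
  exists v : M,
    [/\ N v,
        forall N' : set M, vsubmodule N' -> N' v -> N `<=` N',
        bpJn 0 v = h *: v,
        bpLn 0 v = y *: v
      & forall n : int, 1 <= n ->
          [/\ bpJn n v = 0, bpLn n v = 0, bpGpn n v = 0 & bpGmn (n - 1) v = 0]].

End HighestWeight.

(* Weyl vertex algebra *)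

Definition weyl_relations V (ap am : V) : Prop :=
  [/\ forall (r s : int) (w : V),
        ap \_(r) (am \_(s) w) - am \_(s) (ap \_(r) w)
        = if r + s + 1 == 0 then w else 0,
      forall (r s : int) (w : V), ap \_(r) (ap \_(s) w) = ap \_(s) (ap \_(r) w),
      forall (r s : int) (w : V), am \_(r) (am \_(s) w) = am \_(s) (am \_(r) w)
    & forall n : int, 0 <= n -> ap \_(n) vac = 0 /\ am \_(n) vac = 0].

Definition is_weyl V (ap am : V) : Prop :=
  [/\ weyl_relations ap am,
      generated [set y | y = ap \/ y = am]
    & forall U (bp bm : U), weyl_relations bp bm ->
        exists f : vhom V U, f ap = bp /\ f am = bm].

Definition weyl_bp V (ap am : V) : bp_fields V :=
  BPFields
    (- (1 / 3) *: (ap \_(-1) (am \_(-1) vac)))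
    ((1 / 2) *: (am \_(-2) (ap \_(-1) vac) - ap \_(-2) (am \_(-1) vac)))
    ((1 / 3) *: (ap \_(-1) (ap \_(-1) (ap \_(-1) vac))))
    ((1 / 9) *: (am \_(-1) (am \_(-1) (am \_(-1) vac)))).

Definition direct_sum3 (M : lmodType F) (A B C : set M) : Prop :=
  [/\ subspace A, subspace B, subspace C
    & forall v, exists! p : M * M * M,
        [/\ A p.1.1, B p.1.2, C p.2 & v = p.1.1 + p.1.2 + p.2]].

End Theory.

Section Exponential.
Variable R : realType.

Definition cexp (z : R[i]) : R[i] :=
  let: x +i* y := z in (expR x * cos y) +i* (expR x * sin y).

Definition two_pi_i : R[i] := 0 +i* (2 * pi).

(* g = e^A = \sum_n A^n / n!, the series converging against every linear
   functional; for a locally finite A this is convergence in the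
   finite-dimensional A-invariant subspaces. *)
Definition op_exp (M : lmodType R[i]) (A g : M -> M) : Prop :=
  forall (f : {scalar M}) (v : M),
    (fun N : nat => \sum_(n < N) f (iter n A v) / n`!%:R : R[i]^o) @ \oo
      --> (f (g v) : R[i]^o).

(* {v | g v = e^(2 pi i j / 3) v} *)
Definition cube_eigenspace (M : lmodType R[i]) (g : M -> M) (j : int) : set M :=
  [set v | g v = cexp (two_pi_i * j%:~R / 3) *: v].

End Exponential.

(* Main.v *)
(** The Weyl relations make W spanned by creation monomials. Its grading by
    L_0 = T_(1) shows that a vector killed by all annihilation modes, hence by
    L_0, is a multiple of the vacuum; as annihilation modes act locally
    nilpotently, a nonzero subspace stable under all modes of a+ and a- is W.

    J_0 is diagonalizable on W with eigenvalues in (1/3)Z, so g is defined by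
    functional calculus in J_0, and its multiplicativity is that of exp.

    Let A be the image of the universal algebra. The vectors J, T and their
    derivatives give the quadratic vectors a+_(-n-1) a- for n <= 1, the regular
    part of the operator product of G+ and G- gives n = 2, and the modes of that
    weight 3 vector give the others by induction; the cubic vectors of charge
    +1 and -1 then follow from (a+)^3 and (a-)^3. By associativity every A-stable
    subspace is stable under a+_m a-_n and under triple products of modes of a+
    or of a-, and this forces a nonzero A-stable subspace of an eigenspace of g
    to be the whole eigenspace: hence A = W^(0) and W^(1), W^(-1) are
    irreducible. Finally the L_0-grading of the universal algebra makes its
    maximal ideal unique, which identifies the given simple quotient with A. *)

From mathcomp Require Import all_boot all_order all_algebra.
From mathcomp Require Import complex.
From mathcomp Require Import all_classical all_reals all_analysis.
From mathcomp Require Import ring lra zify.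
Require Import Defs.
Set Implicit Arguments.
Unset Strict Implicit.
Unset Printing Implicit Defensive.

Import Order.TTheory GRing.Theory Num.Theory.
Local Open Scope classical_set_scope.
Local Open Scope ring_scope.
Local Open Scope complex_scope.

(** * Vertex algebra identities *)

Section Subspace.
Variables (F : numFieldType) (M : lmodType F) (P : set M).
Hypothesis sP : subspace P.

Lemma subspace0 : P 0.
Proof. by have [] := sP. Qed.

Lemma subspace_lin c x y : P x -> P y -> P (c *: x + y).
Proof. by have [_] := sP; apply. Qed.

Lemma subspaceZ c x : P x -> P (c *: x).
Proof. by move=> Px; rewrite -[_ *: _]addr0; apply: subspace_lin => //; apply: subspace0. Qed.

Lemma subspaceD x y : P x -> P y -> P (x + y).
Proof. by move=> Px Py; rewrite -[x]scale1r; exact: subspace_lin. Qed.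

Lemma subspaceN x : P x -> P (- x).
Proof. by move=> Px; rewrite -scaleN1r; apply: subspaceZ. Qed.

Lemma subspaceB x y : P x -> P y -> P (x - y).
Proof. by move=> Px Py; apply: subspaceD => //; apply: subspaceN. Qed.

Lemma subspace_sum (I : Type) (r : seq I) (Q : pred I) (f : I -> M) :
  (forall i, Q i -> P (f i)) -> P (\sum_(i <- r | Q i) f i).
Proof.
by move=> h; elim/big_ind: _ => //; [apply: subspace0 | apply: subspaceD].
Qed.

Lemma subspaceZK c x : c != 0 -> P (c *: x) -> P x.
Proof. by move=> c0 /(subspaceZ c^-1); rewrite scalerA mulVf // scale1r. Qed.

End Subspace.

Lemma lin_fun0 (F : numFieldType) (M N : lmodType F) (f : M -> N) : linear f -> f 0 = 0.
Proof. by move=> lf; have := lf (-1) 0 0; rewrite scaler0 addr0 scaleN1r addNr. Qed.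

Lemma lin_funZ (F : numFieldType) (M N : lmodType F) (f : M -> N) : linear f ->
  forall c v, f (c *: v) = c *: f v.
Proof. by move=> lf c v; have := lf c v 0; rewrite (lin_fun0 lf) !addr0. Qed.

Lemma Posz0 : Posz 0 = 0.
Proof. by []. Qed.

Lemma binz0 (F : numFieldType) m : binz F m 0 = 1.
Proof. by rewrite /binz big_ord0 fact0 divr1. Qed.

Lemma binz1 (F : numFieldType) m : binz F m 1 = m%:~R.
Proof. by rewrite /binz big_ord_recl big_ord0 mulr1 subr0 divr1. Qed.

Lemma binz2 (F : numFieldType) m : binz F m 2 = m%:~R * (m%:~R - 1) / 2.
Proof. by rewrite /binz !big_ord_recl big_ord0 /= mulr1 subr0. Qed.

Lemma bin0zS (F : numFieldType) j : binz F 0 j.+1 = 0.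
Proof. by rewrite /binz big_ord_recl /= subr0 !mul0r. Qed.

Section VAlemmas.
Variables (F : numFieldType) (V : vertexAlgebra F).
Implicit Types (a b w : V) (m n l : int).

Lemma vmulDl n a a' b : (a + a') \_(n) b = a \_(n) b + a' \_(n) b.
Proof. by have := vmul_linearl n b 1 a a'; rewrite !scale1r. Qed.

Lemma vmul0l n b : (0 : V) \_(n) b = 0.
Proof. by apply: (addIr (0 \_(n) b)); rewrite -vmulDl !add0r. Qed.

Lemma vmulZl n c a b : (c *: a) \_(n) b = c *: (a \_(n) b).
Proof. by have := vmul_linearl n b c a 0; rewrite !addr0 vmul0l addr0. Qed.

Lemma vmulNl n a b : (- a) \_(n) b = - (a \_(n) b).
Proof. by rewrite -scaleN1r vmulZl scaleN1r. Qed.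

Lemma vmulDr n a b b' : a \_(n) (b + b') = a \_(n) b + a \_(n) b'.
Proof. by have := vmul_linearr a n 1 b b'; rewrite !scale1r. Qed.

Lemma vmul0r n a : a \_(n) (0 : V) = 0.
Proof. by apply: (addIr (a \_(n) 0)); rewrite -vmulDr !add0r. Qed.

Lemma vmulZr n c a b : a \_(n) (c *: b) = c *: (a \_(n) b).
Proof. by have := vmul_linearr a n c b 0; rewrite !addr0 vmul0r addr0. Qed.

Lemma vmulNr n a b : a \_(n) (- b) = - (a \_(n) b).
Proof. by rewrite -scaleN1r vmulZr scaleN1r. Qed.

Lemma vac_vmul0 n b : n != -1 -> (vac : V) \_(n) b = 0.
Proof. by rewrite vac_vmul => /negbTE ->. Qed.

Definition vmul_lin := (vmulDl, vmulDr, vmulZl, vmulZr, vmulNl, vmulNr, vmul0l, vmul0r).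

Lemma subspace_preim (P : set V) a n : subspace P -> subspace [set w | P (a \_(n) w)].
Proof.
move=> sP; split=> [/=|c x y /= Px Py]; first by rewrite vmul0r; exact: subspace0.
by rewrite vmulDr vmulZr; exact: subspace_lin.
Qed.

Lemma vcomm (K : nat) a b m n w :
  (forall j : nat, (K <= j)%N -> a \_(j%:Z) b = 0) ->
  a \_(m) (b \_(n) w) = b \_(n) (a \_(m) w)
    + \sum_(j < K) binz F m j *: ((a \_(j%:Z) b) \_(m + n - j%:Z) w).
Proof.
move=> hK; have [N0 hN] := vmul_borcherds a b w 0 m n.
have := hN (maxn N0 K.+1) (leq_maxl _ _).
have := leq_maxr N0 K.+1; move: (maxn _ _) => [//|N] KN.
rewrite [RHS]big_ord_recl /= [X in _ = _ + X -> _]big1; last first.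
  by move=> j _; rewrite bin0zS mulr0 scale0r.
rewrite binz0 expr0 mul1r scale1r expr0z scale1r Posz0 !addr0 => /esym/eqP; rewrite subr_eq => /eqP ->.
rewrite addrC; congr (_ + _).
rewrite (big_ord_widen _ (fun j : nat => binz F m j *: ((a \_(j%:Z) b) \_(m + n - j%:Z) w)) (ltnW KN)).
rewrite [RHS]big_mkcond /=; apply: eq_bigr => j _; rewrite add0r.
by case: ltnP => // /hK ->; rewrite vmul0l scaler0.
Qed.

(** The Borcherds identity at [m = 0], where only the term j = 0 survives on the left. Modes of
    composite vectors thus become sums of products of modes. *)
Lemma viterate a b l n w : exists N0 : nat, forall N : nat, (N0 <= N)%N ->
  (a \_(l) b) \_(n) w = \sum_(j < N) ((-1) ^+ j * binz F l j) *:
      (a \_(l - j%:Z) (b \_(n + j%:Z) w)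
       - (-1) ^ l *: (b \_(n + l - j%:Z) (a \_(j%:Z) w))).
Proof.
have [N0 hN] := vmul_borcherds a b w l 0 n; exists N0.+1 => -[//|N] hNN.
have := hN N.+1 (ltnW hNN); rewrite big_ord_recl /= big1; last first.
  by move=> j _; rewrite bin0zS scale0r.
rewrite binz0 scale1r Posz0 !addr0 add0r => ->.
by apply: eq_bigr => j _; rewrite !add0r.
Qed.

(** Borcherds identity with [vac] in the second slot and [l = -2]: every mode of [vac] on the right
    vanishes, and on the left only j = 0 and j = 1 remain, carrying [vder a] and [a]. *)
Lemma vderl a n w : vder a \_(n) w = - n%:~R *: (a \_(n - 1) w).
Proof.
have [N0 hN] := vmul_borcherds a vac w (-2) n 0.
have := hN N0.+2 (leq_trans (leqnSn _) (leqnSn _)).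
rewrite !big_ord_recl /= big1 => [|j _]; last first.
  by rewrite vmul_vac_ge0 ?vmul0l ?scaler0 // /bump; lia.
rewrite big1 => [|j _]; last first.
  by rewrite !vac_vmul0 /bump ?vmul0r ?scaler0 ?subr0 ?scaler0 //; lia.
rewrite !vac_vmul0 ?vmul0r /bump //=.
rewrite !scaler0 !subr0 !scaler0 !addr0 binz0 scale1r /bump /= binz1.
rewrite (_ : -2 + (1 + 0)%:Z = -1); last by lia.
rewrite vmul_vacN1 => /eqP; rewrite addr_eq0 => /eqP.
by rewrite -scaleNr.
Qed.

(** Iterate formula evaluated at [vac]: all a_(j) vac vanish, and b_(-2+j) vac survives only for j =
    0, 1. *)
Lemma vder_vmul a n b : vder (a \_(n) b) = a \_(n) vder b - n%:~R *: (a \_(n - 1) b).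
Proof.
rewrite /vder; have [N0 hN] := viterate a b n (-2) vac.
rewrite (hN N0.+2 (leq_trans (leqnSn _) (leqnSn _))) !big_ord_recl /= big1 => [|j _]; last first.
  rewrite (@vmul_vac_ge0 _ _ a) // vmul0r scaler0 subr0 vmul_vac_ge0; last by rewrite /bump; lia.
  by rewrite vmul0r scaler0.
rewrite !(@vmul_vac_ge0 _ _ a) // !vmul0r !scaler0 !subr0 !addr0 expr0 mul1r binz0 scale1r.
rewrite /bump /= binz1 expr1 mulN1r scaleNr.
by rewrite (_ : -2 + (1 + 0)%:Z = -1) ?vmul_vacN1 //; lia.
Qed.

Lemma vder_vac : vder (vac : V) = 0.
Proof. by rewrite /vder vac_vmul. Qed.

(* For m large the terms [b_(_) (a_(m+j) w)] of the Borcherds identity vanish,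
   and it can be solved for [a_(m) b_(n) w] by descending induction on n. *)
Lemma assoc_span (P : set V) a b w : subspace P ->
  (forall i j, P ((a \_(i) b) \_(j) w)) -> forall m n, P (a \_(m) (b \_(n) w)).
Proof.
move=> sP hP.
have [Na hNa] := vmul_trunc a w; have [Nb hNb] := vmul_trunc b w.
suff H : forall (k : nat) m n, Nb <= n + k%:Z -> P (a \_(m) (b \_(n) w)).
  by move=> m n; apply: (H `|Nb - n|%N); lia.
elim=> [|k IH] m n hn; first by rewrite hNb ?vmul0r; [exact: subspace0|lia].
have [N0 hN] := vmul_borcherds a b w (m - Na) Na n.
have := hN N0.+1 (leqnSn _) => {hN} eqB.
have: P (\sum_(j < N0.+1) binz F Na j *: ((a \_(m - Na + j%:Z) b) \_(Na + n - j%:Z) w)).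
  by apply: subspace_sum => // j _; apply: subspaceZ.
rewrite eqB big_ord_recl /= binz0 mulr1 expr0 scale1r => PP.
have: P (\sum_(i < N0) ((-1) ^+ bump 0 i * binz F (m - Na) (bump 0 i)) *:
   (a \_(Na + (m - Na) - (bump 0 i)%:Z) (b \_(n + (bump 0 i)%:Z) w) -
    (-1) ^ (m - Na) *: (b \_(n + (m - Na) - (bump 0 i)%:Z) (a \_(Na + (bump 0 i)%:Z) w)))).
  apply: subspace_sum => // j _; apply: subspaceZ => //.
  rewrite (hNa (Na + _)) ?vmul0r ?scaler0 ?subr0; last by lia.
  by apply: IH; rewrite /bump; lia.
move: PP; set S := (X in _ + X); move=> PP PS.
have := subspaceB sP PP PS; rewrite addrK addr0 (hNa (Na + 0)) ?vmul0r ?scaler0 ?subr0; last by lia.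
by rewrite addrC subrK.
Qed.

(** By the iterate formula, the vectors all of whose modes preserve [K] form a subalgebra; it
    contains the generators. *)
Lemma generated_stable (X K : set V) : generated X -> subspace K ->
  (forall x n w, X x -> K w -> K (x \_(n) w)) ->
  forall a n w, K w -> K (a \_(n) w).
Proof.
move=> gX sK hX.
suff E : [set a | forall n w, K w -> K (a \_(n) w)] = setT.
  by move=> a; have : [set: V] a by []; rewrite -E.
apply: gX => [|x Xx n w]; last exact: hX.
split=> [||a b l Ka Kb n w Kw].
- split=> [n w _|c x y Kx Ky n w Kw]; first by rewrite vmul0l; exact: subspace0.
  by rewrite vmulDl vmulZl; by apply: subspace_lin => //; [exact: Kx | exact: Ky].
- by move=> n w Kw; rewrite vac_vmul; case: ifP => // _; exact: subspace0.
- have [N0 /(_ N0 (leqnn _)) ->] := viterate a b l n w.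
  apply: subspace_sum => // j _; apply: subspaceZ => //.
  apply: subspaceB => //; first by apply: Ka; apply: Kb.
  by apply: subspaceZ => //; apply: Kb; apply: Ka.
Qed.

End VAlemmas.
(** * Functional calculus and gradings *)

Section FunctionalCalculus.
Variables (F : numFieldType) (M : lmodType F) (E : M -> M).
Hypothesis linE : linear E.
Implicit Types (p : {poly F}) (v w : M) (chi : F -> F) (P : set M).

Definition peval p v : M := \sum_(i < size p) p`_i *: iter i E v.

Lemma iter_linear i : linear (iter i E).
Proof. by elim: i => [|i IH] c u v //=; rewrite IH linE. Qed.

Lemma peval_linear p : linear (peval p).
Proof.
move=> c u v; rewrite /peval scaler_sumr -big_split /=; apply: eq_bigr => i _.
by rewrite iter_linear scalerDr !scalerA mulrC.
Qed.

Lemma iter_eigen i l v : E v = l *: v -> iter i E v = l ^+ i *: v.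
Proof.
move=> Ev; elim: i => [|i IH]; first by rewrite expr0 scale1r.
by rewrite iterS IH (lin_funZ linE) Ev scalerA -exprSr.
Qed.

Lemma peval_eigen p l v : E v = l *: v -> peval p v = p.[l] *: v.
Proof.
move=> Ev; rewrite /peval horner_coef scaler_suml; apply: eq_bigr => i _.
by rewrite (iter_eigen _ Ev) scalerA.
Qed.

Lemma peval_stable P p v : subspace P -> (forall u, P u -> P (E u)) -> P v -> P (peval p v).
Proof.
move=> sP EP Pv; apply: subspace_sum => // i _; apply: subspaceZ => //.
by elim: (i : nat) => [//|k IH]; rewrite iterS; apply: EP.
Qed.

Lemma interpolation chi (s : seq F) : exists p, forall x, x \in s -> p.[x] = chi x.
Proof.
elim: s => [|x s [p hp]]; first by exists 0.
have [xs|xs] := boolP (x \in s).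
  by exists p => y; rewrite inE => /orP[/eqP ->|]; apply: hp.
have Q0 : (\prod_(y <- s) ('X - y%:P)).[x] != 0.
  by apply: contra xs => /eqP h; rewrite -root_prod_XsubC; apply/eqP.
(* Newton interpolation: the correction vanishes at the earlier nodes and repairs the value at the
   new one. *)
exists (p + ((chi x - p.[x]) / (\prod_(y <- s) ('X - y%:P)).[x]) *: \prod_(y <- s) ('X - y%:P)).
move=> y; rewrite inE => /orP[/eqP ->|ys]; rewrite hornerD hornerZ.
  by rewrite divfK // addrC subrK.
have /eqP -> : root (\prod_(y <- s) ('X - y%:P)) y by rewrite root_prod_XsubC.
by rewrite mulr0 addr0 hp.
Qed.

(** Expresses that the eigenvectors with eigenvalue in [L] span, in the form of an induction
    principle that avoids finite sums. *)
Definition diagonalizable (L : set F) :=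
  forall P, subspace P -> (forall l v, L l -> E v = l *: v -> P v) -> forall v, P v.

(* [u] is [chi(E) v]: the value at [v] of any polynomial in [E] interpolating
   [chi] at the eigenvalues occurring in [v]. *)
Definition fcalc_rel chi v u :=
  exists s : seq F, forall p, (forall x, x \in s -> p.[x] = chi x) -> peval p v = u.

Lemma fcalc_rel_uniq chi v u u' : fcalc_rel chi v u -> fcalc_rel chi v u' -> u = u'.
Proof.
move=> [s hs] [s' hs']; have [p hp] := interpolation chi (s ++ s').
by rewrite -(hs p) ?(hs' p) // => x xs; apply: hp; rewrite mem_cat xs ?orbT.
Qed.

Lemma fcalc_rel_lin chi c v v' u u' :
  fcalc_rel chi v u -> fcalc_rel chi v' u' -> fcalc_rel chi (c *: v + v') (c *: u + u').
Proof.
move=> [s hs] [s' hs']; exists (s ++ s') => p hp.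
by rewrite peval_linear (hs p) ?(hs' p) // => x xs; apply: hp; rewrite mem_cat xs ?orbT.
Qed.

Lemma fcalc_rel_eigen chi l v : E v = l *: v -> fcalc_rel chi v (chi l *: v).
Proof.
move=> Ev; exists [:: l] => p hp; rewrite (peval_eigen _ Ev) hp //.
by rewrite inE.
Qed.

(** Defaults to 0 when no value exists, so that [fcalc] is total and can be defined before
    diagonalizability is assumed. *)
Lemma fcalc_ex chi v :
  {u | (exists w, fcalc_rel chi v w) -> fcalc_rel chi v u}.
Proof.
apply: cid; have [[w hw]|no] := pselect (exists w, fcalc_rel chi v w); first by exists w.
by exists 0.
Qed.

Definition fcalc chi v : M := sval (fcalc_ex chi v).

Section Diag.
Variable L : set F.
Hypothesis diagE : diagonalizable L.

Lemma fcalcP chi v : fcalc_rel chi v (fcalc chi v).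
Proof.
rewrite /fcalc; case: fcalc_ex => u /= hu; apply: hu; move: v {u}.
apply: diagE => [|l v _ Ev]; last by exists (chi l *: v); exact: fcalc_rel_eigen.
split=> [|c x y [u hu] [u' hu']]; last by exists (c *: u + u'); exact: fcalc_rel_lin.
by exists (chi 0 *: 0); apply: fcalc_rel_eigen; rewrite (lin_fun0 linE) scaler0.
Qed.

Lemma fcalc_linear chi : linear (fcalc chi).
Proof.
move=> c u v; apply: (fcalc_rel_uniq (fcalcP _ _)).
by apply: fcalc_rel_lin; exact: fcalcP.
Qed.

Lemma fcalc_eigen chi l v : E v = l *: v -> fcalc chi v = chi l *: v.
Proof. by move=> Ev; apply: (fcalc_rel_uniq (fcalcP _ _)); exact: fcalc_rel_eigen. Qed.

(** On each vector, [fcalc chi] agrees with some polynomial in [E]. *)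
Lemma fcalc_stable P chi v :
  subspace P -> (forall u, P u -> P (E u)) -> P v -> P (fcalc chi v).
Proof.
move=> sP EP Pv; have [s hs] := fcalcP chi v; have [p hp] := interpolation chi s.
by rewrite -(hs p hp); exact: peval_stable.
Qed.

End Diag.

Lemma diagonalizable_eq (L : set F) (f g : M -> M) : diagonalizable L ->
  linear f -> linear g -> (forall l v, L l -> E v = l *: v -> f v = g v) -> f =1 g.
Proof.
move=> dE lf lg h; apply: dE => //.
split=> [|c x y fx fy]; last by rewrite lf lg fx fy.
by rewrite (lin_fun0 lf) (lin_fun0 lg).
Qed.

Variable v0 : M.

(** The space is spanned by [v0], of weight 0, and eigenvectors of positive weight in (1/2)Z.
    Half-integers are needed because a+ and a- have weight 1/2, and G+ and G- weight 3/2. *)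
Definition pos_graded := E v0 = 0 /\
  forall P, subspace P -> P v0 ->
    (forall (d : nat) v, E v = (d.+1%:R / 2) *: v -> P v) -> forall v, P v.

Hypothesis gradE : pos_graded.

Lemma pos_graded_diagonalizable : diagonalizable setT.
Proof.
case: gradE => E0 gE P sP hP; apply: gE => // [|d v]; last exact: hP.
by apply: (hP 0) => //; rewrite scale0r.
Qed.

(** The projection onto weight 0, obtained by applying the indicator function of 0 to [E]. *)
Let pi0 := fcalc (fun z => (z == 0)%:R).

Lemma fcalc0_v0 : pi0 v0 = v0.
Proof.
rewrite /pi0 (fcalc_eigen pos_graded_diagonalizable _ (l := 0)) ?eqxx ?scale1r //.
by rewrite scale0r; case: gradE.
Qed.

Lemma fcalc0_line v : exists c, pi0 v = c *: v0.
Proof.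
have linp := fcalc_linear pos_graded_diagonalizable (fun z => (z == 0)%:R).
move: v; case: gradE => E0 gE; apply: gE => [||d v Ev].
- split=> [|c x y [a ha] [b hb]].
    by exists 0; rewrite scale0r /pi0 (lin_fun0 linp).
  by exists (c * a + b); rewrite /pi0 linp -/pi0 ha hb scalerDl scalerA.
- by exists 1; rewrite scale1r fcalc0_v0.
- exists 0; rewrite scale0r /pi0 (fcalc_eigen pos_graded_diagonalizable _ Ev).
  by rewrite mulf_eq0 invr_eq0 !pnatr_eq0 scale0r.
Qed.

Lemma pos_graded_ker w : E w = 0 -> exists c, w = c *: v0.
Proof.
move=> Ew; have [c hc] := fcalc0_line w; exists c; rewrite -hc.
by rewrite /pi0 (fcalc_eigen pos_graded_diagonalizable _ (l := 0)) ?eqxx ?scale1r ?scale0r.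
Qed.

(** The projection [pi0] preserves [I] and [I'] and has values in the line of [v0]. Since
    [pi0 a + pi0 b = v0], one of the two is a nonzero multiple of [v0]. *)
Lemma pos_graded_split (I I' : set M) a b : subspace I -> subspace I' ->
  (forall u, I u -> I (E u)) -> (forall u, I' u -> I' (E u)) ->
  I a -> I' b -> v0 = a + b -> I v0 \/ I' v0.
Proof.
move=> sI sI' EI EI' Ia Ib eab.
have lp := fcalc_linear pos_graded_diagonalizable (fun z => (z == 0)%:R).
have := fcalc0_v0; rewrite {1}eab -[a]scale1r /pi0 lp -/pi0 scale1r => <-.
have Ipa : I (pi0 a) by exact: (fcalc_stable pos_graded_diagonalizable).
have Ipb : I' (pi0 b) by exact: (fcalc_stable pos_graded_diagonalizable).
have [c hc] := fcalc0_line a; have [d hd] := fcalc0_line b.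
have [c0|c0] := eqVneq c 0.
  by right; rewrite hc c0 scale0r add0r.
left; rewrite hd; apply: subspaceD => //; apply: subspaceZ => //.
by apply: (subspaceZK sI c0); rewrite -hc.
Qed.

End FunctionalCalculus.
(** * Linear combinations by reflection *)

Section ModuleReflection.
Variables (F : numFieldType) (M : lmodType F).

Inductive mexp :=
  | MZero | MAtom of nat | MAdd of mexp & mexp | MOpp of mexp | MScale of F & mexp.

Fixpoint meval (env : seq M) (e : mexp) : M :=
  match e with
  | MZero => 0
  | MAtom i => env`_i
  | MAdd a b => meval env a + meval env b
  | MOpp a => - meval env a
  | MScale c a => c *: meval env a
  end.

Fixpoint mcoef (e : mexp) (i : nat) : F :=
  match e with
  | MZero => 0
  | MAtom j => if eqn i j then 1 else 0
  | MAdd a b => mcoef a i + mcoef b i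
  | MOpp a => - mcoef a i
  | MScale c a => c * mcoef a i
  end.

(** Unfolds to one scalar equation per atom, each left to [field]. Equality of coefficients suffices
    whatever linear relations hold between the atoms. *)
Fixpoint mcheck (n : nat) (e1 e2 : mexp) : Prop :=
  if n is k.+1 then mcoef e1 k = mcoef e2 k /\ mcheck k e1 e2 else True.

Lemma mevalE env e : meval env e = \sum_(i < size env) mcoef e i *: env`_i.
Proof.
elim: e => [|j|a IHa b IHb|a IHa|c a IHa] /=.
- by rewrite big1 // => i _; rewrite scale0r.
- have [js|js] := ltnP j (size env).
    rewrite (bigD1 (Ordinal js)) //= eqnE eqxx scale1r big1 ?addr0 // => i ij.
    by rewrite ifN ?scale0r //; apply: contra ij => /eqP e; apply/eqP/val_inj.
  rewrite nth_default // big1 // => i _.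
  by rewrite eqnE ifN ?scale0r // neq_ltn (leq_trans (ltn_ord i) js).
- by rewrite IHa IHb -big_split; apply: eq_bigr => i _; rewrite scalerDl.
- by rewrite IHa -sumrN; apply: eq_bigr => i _; rewrite scaleNr.
- by rewrite IHa scaler_sumr; apply: eq_bigr => i _; rewrite scalerA.
Qed.

Lemma meval_eq env e1 e2 : mcheck (size env) e1 e2 -> meval env e1 = meval env e2.
Proof.
rewrite !mevalE; elim: (size env) => [|n IH] /=; first by rewrite !big_ord0.
by rewrite !big_ord_recr /= => -[-> /IH ->].
Qed.

End ModuleReflection.

Ltac mem_atom x l :=
  lazymatch l with
  | nil => false
  | cons x _ => true
  | cons _ ?l' => mem_atom x l'
  end.

Ltac collect_atoms l e :=
  lazymatch e with
  | 0 => l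
  | ?a + ?b => let l := collect_atoms l a in collect_atoms l b
  | - ?a => collect_atoms l a
  | _ *: ?a => collect_atoms l a
  | _ => let b := mem_atom e l in
         lazymatch b with true => l | false => constr:(cons e l) end
  end.

Ltac index_atom x l :=
  lazymatch l with
  | cons x _ => constr:(O)
  | cons _ ?l' => let n := index_atom x l' in constr:(S n)
  end.

Ltac reify_mexp F l e :=
  lazymatch e with
  | 0 => constr:(@MZero F)
  | ?a + ?b => let a := reify_mexp F l a in let b := reify_mexp F l b in
               constr:(MAdd a b)
  | - ?a => let a := reify_mexp F l a in constr:(MOpp a)
  | ?c *: ?a => let a := reify_mexp F l a in constr:(MScale (c : F) a)
  | _ => let n := index_atom e l in constr:(@MAtom F n)
  end.

(* Equality of two linear combinations, reduced to equations between the
   coefficients of each atom. *)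
Ltac lincomb F M :=
  lazymatch goal with
  | |- @eq _ ?a ?b =>
    let l := collect_atoms (@nil M) a in
    let l := collect_atoms l b in
    let ea := reify_mexp F l a in
    let eb := reify_mexp F l b in
    change (@eq M (@meval F M l ea) (@meval F M l eb));
    apply: meval_eq; cbn [size mcheck mcoef eqn]; repeat split; by field
  end.
(** * The Weyl vertex algebra *)

Section Commutators.
Variables (F : numFieldType) (V : vertexAlgebra F).
Implicit Types (a b w : V) (m n : int).

Lemma vcomm0 a b m n w : (forall j : nat, a \_(j%:Z) b = 0) ->
  a \_(m) (b \_(n) w) = b \_(n) (a \_(m) w).
Proof. by move=> h; rewrite (vcomm (K := 0)) ?big_ord0 ?addr0. Qed.

Lemma vcomm1 a b m n w : (forall j : nat, a \_(j.+1%:Z) b = 0) ->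
  a \_(m) (b \_(n) w) = b \_(n) (a \_(m) w) + (a \_(0) b) \_(m + n) w.
Proof.
move=> h; rewrite (vcomm (K := 1)) => [|[|j] //].
by rewrite big_ord_recl big_ord0 binz0 scale1r Posz0 !addr0.
Qed.

Lemma vcomm2 a b m n w : (forall j : nat, a \_(j.+2%:Z) b = 0) ->
  a \_(m) (b \_(n) w) = b \_(n) (a \_(m) w) + (a \_(0) b) \_(m + n) w
    + m%:~R *: ((a \_(1) b) \_(m + n - 1) w).
Proof.
move=> h; rewrite (vcomm (K := 2)) => [|[|[|j]] //].
by rewrite !big_ord_recl big_ord0 binz0 scale1r Posz0 !addr0 binz1 addrA.
Qed.

(** A zero mode is a derivation of every product, since in the commutator formula with m = 0 only j
    = 0 contributes. *)
Lemma vcomm_0 a b n w : a \_(0) (b \_(n) w) = (a \_(0) b) \_(n) w + b \_(n) (a \_(0) w).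
Proof.
have [N hN] := vmul_trunc a b.
rewrite (vcomm (K := `|N|.+1)) => [|j hj]; last by apply: hN; lia.
rewrite addrC; congr (_ + _).
rewrite big_ord_recl /= binz0 scale1r Posz0 add0r !addr0 big1 ?addr0 // => j _.
by rewrite /bump /= bin0zS scale0r.
Qed.

End Commutators.

Section Weyl.
Variables (F : numFieldType) (W : vertexAlgebra F).

(** The symplectic symmetry (a+, a-) to (a-, -a+), by which statements proved for a+ transfer to
    a-. *)
Lemma weyl_swap (ap am : W) : weyl_relations ap am -> weyl_relations am (- ap).
Proof.
move=> [h1 h2 h3 h4]; split=> [r s w|//|r s w|n n0].
- rewrite !vmulNl vmulNr opprK addrC h1 (_ : s + r = r + s) //; exact: addrC.
- by rewrite !vmulNl !vmulNr !opprK h2.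
- by rewrite vmulNl; have [-> ->] := h4 _ n0; rewrite oppr0.
Qed.

Variables ap am : W.
Hypothesis rel : weyl_relations ap am.
Implicit Types (w : W) (m n r s : int).

Lemma ap_am r s w :
  ap \_(r) (am \_(s) w) = am \_(s) (ap \_(r) w) + (if r + s + 1 == 0 then w else 0).
Proof. by have [h _ _ _] := rel; rewrite -(h r s w) addrC subrK. Qed.

Lemma am_ap r s w :
  am \_(r) (ap \_(s) w) = ap \_(s) (am \_(r) w) - (if r + s + 1 == 0 then w else 0).
Proof. by rewrite ap_am (addrC s r) addrK. Qed.

Lemma ap_am_contr r s w : r + s + 1 = 0 -> ap \_(r) (am \_(s) w) = am \_(s) (ap \_(r) w) + w.
Proof. by move=> h; rewrite ap_am h eqxx. Qed.

Lemma ap_ap r s w : ap \_(r) (ap \_(s) w) = ap \_(s) (ap \_(r) w).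
Proof. by have [_ h _ _] := rel; rewrite h. Qed.

Lemma am_am r s w : am \_(r) (am \_(s) w) = am \_(s) (am \_(r) w).
Proof. by have [_ _ h _] := rel; rewrite h. Qed.

Lemma ap_vac n : 0 <= n -> ap \_(n) vac = 0.
Proof. by have [_ _ _ h] := rel => /h []. Qed.

Lemma am_vac n : 0 <= n -> am \_(n) vac = 0.
Proof. by have [_ _ _ h] := rel => /h []. Qed.

Lemma ap_neq0 : ap != 0.
Proof.
apply/eqP => e; have := vac_neq0 W; have := @ap_am_contr 0 (-1) vac.
by move=> /(_ (erefl _)); rewrite e !vmul0l vmul0r add0r => <-; rewrite eqxx.
Qed.

Lemma ap_am_ge0 (j : nat) : ap \_(j%:Z) am = if j == 0%N then vac else 0.
Proof.
rewrite -[am]vmul_vacN1 ap_am ap_vac // vmul0r add0r.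
by rewrite subrK; case: j.
Qed.

Lemma ap_ap_ge0 (j : nat) : ap \_(j%:Z) ap = 0.
Proof. by rewrite -{2}[ap]vmul_vacN1 ap_ap ap_vac // vmul0r. Qed.

Hypothesis gen : generated [set y | y = ap \/ y = am].

(** The span of creation monomials is also stable under annihilation modes, which move to the right
    until they meet [vac]. It is then stable under all modes, and contains every w = w_(-1) vac. *)
Lemma weyl_strongly_generated : strongly_generated [set y | y = ap \/ y = am].
Proof.
move=> P sP Pvac hP.
(* [K] is the least subspace containing [vac] and stable under creation modes, encoded as an
   intersection. *)
pose K w := forall Q : set W, subspace Q -> Q vac ->
  (forall (n : nat) v, Q v -> Q (ap \_(- n.+1%:Z) v) /\ Q (am \_(- n.+1%:Z) v)) -> Q w.
have sK : subspace K.
  split=> [Q sQ _ _|c x y Kx Ky Q sQ Qv hQ]; first exact: subspace0.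
  by apply: subspace_lin => //; [exact: Kx | exact: Ky].
have Kvac : K vac by [].
have Kcr (n : nat) v : K v -> K (ap \_(- n.+1%:Z) v) /\ K (am \_(- n.+1%:Z) v).
  by move=> Kv; split=> Q sQ Qv hQ; have [] := hQ n v (Kv Q sQ Qv hQ).
have Kann (n : nat) v : K v -> K (ap \_(n%:Z) v) /\ K (am \_(n%:Z) v).
  (* Membership in [K] is carried along in the induction, because the contraction of an annihilation
     mode with a creation mode returns the vector itself. *)
  move=> Kv; apply: (Kv [set v | K v /\ (K (ap \_(n%:Z) v) /\ K (am \_(n%:Z) v))] _ _ _).2.
  - split=> [|c x y [Kx [px mx]] [Ky [py my]]].
      by rewrite /= !vmul0r; split; [|split]; exact: (subspace0 sK).
    by rewrite /= !vmulDr !vmulZr; split; [|split]; exact: (subspace_lin sK).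
  - by split=> //; rewrite ap_vac // am_vac //; split; exact: subspace0.
  - move=> k u [Ku [pu mu]]; have [pk mk] := Kcr k u Ku.
    split; split=> //.
      rewrite ap_ap; split; first exact: (Kcr _ _ _).1.
      rewrite am_ap; apply: (subspaceB sK) => //; first exact: (Kcr _ _ mu).1.
      by case: ifP => // _; exact: (subspace0 sK).
    rewrite am_am; split; last exact: (Kcr _ _ _).2.
    rewrite ap_am; apply: (subspaceD sK) => //; first exact: (Kcr _ _ pu).2.
    by case: ifP => // _; exact: (subspace0 sK).
have Kall : forall w, K w.
  move=> w; rewrite -[w]vmul_vacN1.
  apply: (generated_stable gen sK) => // x n v [->|->] Kv.
    by have [n0|n0] := lerP 0 n; [rewrite -[n]gez0_abs //; exact: (Kann _ _ Kv).1
      | rewrite (_ : n = - (`|n|%N.-1.+1)%:Z); [exact: (Kcr _ _ Kv).1 | lia]].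
  by have [n0|n0] := lerP 0 n; [rewrite -[n]gez0_abs //; exact: (Kann _ _ Kv).2
      | rewrite (_ : n = - (`|n|%N.-1.+1)%:Z); [exact: (Kcr _ _ Kv).2 | lia]].
apply/seteqP; split=> // w _; apply: Kall => // n v Pv.
by split; apply: hP => //; [left | right].
Qed.

(** Equals -3 J. Working without the scalars of the Bershadsky-Polyakov fields keeps the
    computations integral. *)
Definition weyl_jj : W := ap \_(-1) (am \_(-1) vac).

(** Read off from the commutator taken in the other order: the products of a+ with the quadratic
    vector are immediate, and only the one at j = 0 is nonzero. *)
Lemma jj_ap n m w : weyl_jj \_(n) (ap \_(m) w) =
  ap \_(m) (weyl_jj \_(n) w) - ap \_(m + n) w.
Proof.
have h j : ap \_(j%:Z) weyl_jj = if j == 0%N then ap else 0.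
  by rewrite /weyl_jj vmul_vacN1 ap_ap ap_am_ge0; case: j => [|j] /=; rewrite ?vmul_vacN1 ?vmul0r.
by rewrite [in RHS]vcomm1 ?(h 0%N) ?addrK // => j; rewrite h.
Qed.

Lemma am_am_ge0 (j : nat) : am \_(j%:Z) am = 0.
Proof. by rewrite -{2}[am]vmul_vacN1 am_am am_vac // vmul0r. Qed.

Lemma am_ap_ge0 (j : nat) : am \_(j%:Z) ap = - if j == 0%N then vac else 0.
Proof.
rewrite -[ap]vmul_vacN1 am_ap am_vac // vmul0r add0r.
by rewrite subrK; case: j.
Qed.

Lemma jj_am n m w : weyl_jj \_(n) (am \_(m) w) =
  am \_(m) (weyl_jj \_(n) w) + am \_(m + n) w.
Proof.
have h j : am \_(j%:Z) weyl_jj = if j == 0%N then - am else 0.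
  by rewrite /weyl_jj vmul_vacN1 am_ap am_am_ge0 vmul0r add0r subrK; case: j => [|j] //=; rewrite oppr0.
by rewrite [in RHS]vcomm1 ?(h 0%N) ?vmulNl ?subrK // => j; rewrite h.
Qed.

Definition weyl_omega : W :=
  (1 / 2) *: (am \_(-2) (ap \_(-1) vac) - ap \_(-2) (am \_(-1) vac)).

(** At n = 1 this gives a+_(m) the conformal weight -m - 1/2. Only the products of a+ with omega at
    j = 0 and j = 1 contribute to the commutator. *)
Lemma omega_ap n m w : weyl_omega \_(n) (ap \_(m) w) =
  ap \_(m) (weyl_omega \_(n) w) - (m%:~R + n%:~R / 2) *: (ap \_(m + n - 1) w).
Proof.
have h j : ap \_(j%:Z) weyl_omega =
    if j is j'.+1 then (if j' == 0%N then (1 / 2) *: ap else 0) else - (1 / 2) *: vder ap.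
  rewrite /weyl_omega !vmul_vacN1 vmulZr vmulDr vmulNr ap_am ap_ap_ge0 vmul0r add0r ap_ap ap_am_ge0.
  case: j => [|[|j]] /=; first by rewrite sub0r scalerN scaleNr.
    by rewrite vmul0r subr0.
  by rewrite ifN ?vmul0r ?subr0 ?scaler0 //; lia.
rewrite [in RHS]vcomm2 => [|j]; last by rewrite h.
rewrite (h 0%N) (h 1%N) /= !vmulZl vderl intrD.
lincomb F W.
Qed.

Lemma omega_am n m w : weyl_omega \_(n) (am \_(m) w) =
  am \_(m) (weyl_omega \_(n) w) - (m%:~R + n%:~R / 2) *: (am \_(m + n - 1) w).
Proof.
have h j : am \_(j%:Z) weyl_omega =
    if j is j'.+1 then (if j' == 0%N then (1 / 2) *: am else 0) else - (1 / 2) *: vder am.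
  rewrite /weyl_omega !vmul_vacN1 vmulZr vmulDr vmulNr am_ap am_am_ge0 vmul0r sub0r am_am am_ap_ge0.
  case: j => [|[|j]] /=; first by rewrite vmulNr !oppr0 addr0 scalerN scaleNr.
    by rewrite oppr0 vmul0r add0r opprK.
  by rewrite ifN ?oppr0 ?vmul0r ?oppr0 ?addr0 ?scaler0 //; lia.
rewrite [in RHS]vcomm2 => [|j]; last by rewrite h.
rewrite (h 0%N) (h 1%N) /= !vmulZl vderl intrD.
lincomb F W.
Qed.

Definition weyl_sqr : W := ap \_(-1) (ap \_(-1) vac).
Definition weyl_cube : W := ap \_(-1) weyl_sqr.

Lemma sqr_ap n m w : weyl_sqr \_(n) (ap \_(m) w) = ap \_(m) (weyl_sqr \_(n) w).
Proof. by rewrite (vcomm0 (a := ap)) // => j; rewrite /weyl_sqr vmul_vacN1 ap_ap ap_ap_ge0 vmul0r. Qed.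

Lemma cube_ap n m w : weyl_cube \_(n) (ap \_(m) w) = ap \_(m) (weyl_cube \_(n) w).
Proof.
by rewrite (vcomm0 (a := ap)) // => j; rewrite /weyl_cube /weyl_sqr vmul_vacN1 ap_ap [X in ap \_(-1) X]ap_ap ap_ap_ge0 !vmul0r.
Qed.

Lemma am_sqr (j : nat) : am \_(j%:Z) weyl_sqr = if j == 0%N then - 2 *: ap else 0.
Proof.
rewrite /weyl_sqr vmul_vacN1 am_ap am_ap_ge0 subrK; case: j => [|j] /=.
  by rewrite vmulNr vmul_vacN1; lincomb F W.
by rewrite !oppr0 vmul0r addr0.
Qed.

Lemma am_cube (j : nat) : am \_(j%:Z) weyl_cube = if j == 0%N then - 3 *: weyl_sqr else 0.
Proof.
rewrite /weyl_cube am_ap am_sqr subrK; case: j => [|j] /=.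
  by rewrite vmulZr -[X in ap \_(-1) X]vmul_vacN1 -/weyl_sqr; lincomb F W.
by rewrite vmul0r subr0.
Qed.

Lemma sqr_am n m w : weyl_sqr \_(n) (am \_(m) w) =
  am \_(m) (weyl_sqr \_(n) w) + 2 *: (ap \_(m + n) w).
Proof.
by rewrite [in RHS]vcomm1 ?(am_sqr 0%N) ?vmulZl ?scaleNr ?subrK // => j; rewrite am_sqr.
Qed.

Lemma cube_am n m w : weyl_cube \_(n) (am \_(m) w) =
  am \_(m) (weyl_cube \_(n) w) + 3 *: (weyl_sqr \_(m + n) w).
Proof.
by rewrite [in RHS]vcomm1 ?(am_cube 0%N) ?vmulZl ?scaleNr ?subrK // => j; rewrite am_cube.
Qed.
End Weyl.

(** * Normal ordering in the Weyl algebra by rewriting *)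

Section WeylComputation.
Variables (F : numFieldType) (W : vertexAlgebra F) (ap am : W).
Hypothesis rel : weyl_relations ap am.
Implicit Types (a w : W) (m n : nat).

Lemma vac_ann a n : a \_(Posz n) vac = 0.
Proof. exact: vmul_vac_ge0. Qed.

Lemma ap_am_ann m n w : ap \_(Posz m) (am \_(Negz n) w) =
  am \_(Negz n) (ap \_(Posz m) w) + if m == n then w else 0.
Proof. by rewrite (ap_am rel); congr (_ + _); congr (if _ then _ else _); lia. Qed.

Lemma am_ap_ann m n w : am \_(Posz m) (ap \_(Negz n) w) =
  ap \_(Negz n) (am \_(Posz m) w) - if m == n then w else 0.
Proof. by rewrite (am_ap rel); congr (_ + _); congr (- if _ then _ else _); lia. Qed.

Lemma am_ap_crea m n w :
  am \_(Negz m) (ap \_(Negz n) w) = ap \_(Negz n) (am \_(Negz m) w).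
Proof. by rewrite (am_ap rel); case: eqP => [h|_]; [lia | rewrite subr0]. Qed.

Lemma ap_ap_ann m n w :
  ap \_(Posz m) (ap \_(Negz n) w) = ap \_(Negz n) (ap \_(Posz m) w).
Proof. exact: (ap_ap rel). Qed.

Lemma am_am_ann m n w :
  am \_(Posz m) (am \_(Negz n) w) = am \_(Negz n) (am \_(Posz m) w).
Proof. exact: (am_am rel). Qed.

Lemma vder_ap m w : vder (ap \_(Negz m) w) = ap \_(Negz m) (vder w) + m.+1%:R *: (ap \_(Negz m.+1) w).
Proof.
rewrite vder_vmul (_ : Negz m - 1 = Negz m.+1); last by lia.
by rewrite NegzE rmorphN /= scaleNr opprK.
Qed.

Lemma vder_am m w : vder (am \_(Negz m) w) = am \_(Negz m) (vder w) + m.+1%:R *: (am \_(Negz m.+1) w).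
Proof.
rewrite vder_vmul (_ : Negz m - 1 = Negz m.+1); last by lia.
by rewrite NegzE rmorphN /= scaleNr opprK.
Qed.

Lemma intr_Posz (n : nat) : (Posz n)%:~R = n%:R :> F.
Proof. by []. Qed.

Lemma intr_Negz (n : nat) : (Negz n)%:~R = - n.+1%:R :> F.
Proof. by []. Qed.

Lemma vderD (a b : W) : vder (a + b) = vder a + vder b.
Proof. exact: vmulDl. Qed.

Lemma vderZ c (a : W) : vder (c *: a) = c *: vder a.
Proof. exact: vmulZl. Qed.

Lemma vderN (a : W) : vder (- a) = - vder a.
Proof. exact: vmulNl. Qed.

(** Modes of composite vectors and annihilation modes move right until they meet [vac], derivatives
    move inwards, and creation modes of a- move right of those of a+. Matching on [Posz] and [Negz]
    fixes the orientation and prevents loops. *)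
Definition weyl_rules := (jj_ap rel, jj_am rel, omega_ap rel, omega_am rel,
  sqr_ap rel, sqr_am rel, cube_ap rel, cube_am rel,
  vac_ann, ap_am_ann, am_ap_ann, am_ap_crea, ap_ap_ann, am_am_ann,
  @vmulDr F W, @vmulZr F W, @vmulNr F W, @vmul0r F W,
  vderD, vderZ, vderN, vder_ap, vder_am, @vder_vac F W,
  @vmulDl F W, @vmulZl F W, @vmulNl F W, @vmul0l F W).

End WeylComputation.

(* Puts mode indices in the constructor form [Posz _] or [Negz _]. *)
Ltac eval_modes :=
  repeat match goal with
  | |- context [@vmul ?F ?V ?a ?e ?b] =>
    let k := eval vm_compute in e in
    tryif constr_eq e k then fail else
    lazymatch k with
    | Posz _ => change (@vmul F V a e b) with (@vmul F V a k b)
    | Negz _ => change (@vmul F V a e b) with (@vmul F V a k b)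
    end
  end.

Ltac weyl_eval rel :=
  eval_modes; repeat (rewrite !(weyl_rules rel); eval_modes);
  rewrite /= ?nth_nil ?intr_Posz ?intr_Negz.
(** * The Bershadsky-Polyakov relations *)

Section WeylOPE.
Variables (F : numFieldType) (W : vertexAlgebra F) (ap am : W).
Hypothesis rel : weyl_relations ap am.

Lemma ope_jj_jj : ope (weyl_jj ap am) (weyl_jj ap am) [:: 0; - vac].
Proof.
move=> n; rewrite {2}/weyl_jj.
case: n => [|[|[|n]]]; weyl_eval rel; lincomb F W.
Qed.

Lemma ope_cube_cube : ope (weyl_cube ap) (weyl_cube ap) [::].
Proof.
by move=> n; rewrite {2}/weyl_cube /weyl_sqr; weyl_eval rel.
Qed.

Lemma ope_jj_cube : ope (weyl_jj ap am) (weyl_cube ap) [:: - 3 *: weyl_cube ap].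
Proof.
move=> n; rewrite /weyl_cube /weyl_sqr.
case: n => [|n]; weyl_eval rel; lincomb F W.
Qed.

Lemma ope_omega_omega : ope (weyl_omega ap am) (weyl_omega ap am)
  [:: vder (weyl_omega ap am); 2 *: weyl_omega ap am; 0; - (1 / 2) *: vac].
Proof.
move=> n; rewrite [X in _ \_(_) X]/weyl_omega.
case: n => [|[|[|[|n]]]]; weyl_eval rel.
- rewrite /weyl_omega; weyl_eval rel; lincomb F W.
- rewrite /weyl_omega; weyl_eval rel; lincomb F W.
- lincomb F W.
- lincomb F W.
- lincomb F W.
Qed.

Lemma ope_omega_cube : ope (weyl_omega ap am) (weyl_cube ap)
  [:: vder (weyl_cube ap); (3 / 2) *: weyl_cube ap].
Proof.
move=> n; rewrite /weyl_cube /weyl_sqr.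
case: n => [|[|n]]; weyl_eval rel.
all: lincomb F W.
Qed.

Lemma ope_omega_jj : ope (weyl_omega ap am) (weyl_jj ap am)
  [:: vder (weyl_jj ap am); weyl_jj ap am].
Proof.
move=> n; rewrite /weyl_jj.
case: n => [|[|[|n]]]; weyl_eval rel; lincomb F W.
Qed.

(** After scaling by 1/3 * 1/9 = 1/27 this is the G+ G- relation at k = -5/3; for instance 36/27 = k
    + 3. *)
Lemma ope_cube_cubeS : ope (weyl_cube ap) (weyl_cube am)
  [:: 9 *: (weyl_jj ap am \_(-1) weyl_jj ap am) + 9 *: vder (weyl_jj ap am)
        - 36 *: weyl_omega ap am;
      18 *: weyl_jj ap am; 6 *: vac].
Proof.
move=> n; rewrite [weyl_cube am]/weyl_cube /weyl_sqr.
case: n => [|[|[|n]]]; weyl_eval rel.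
- rewrite (vmul_vacN1 (weyl_sqr ap)) (vmul_vacN1 (weyl_jj ap am)).
  rewrite /weyl_omega /weyl_sqr /weyl_jj; weyl_eval rel; lincomb F W.
- rewrite /weyl_jj; weyl_eval rel; lincomb F W.
- lincomb F W.
- lincomb F W.
Qed.

Lemma ope_jj_cubeS : ope (weyl_jj ap am) (weyl_cube am) [:: 3 *: weyl_cube am].
Proof.
move=> n; rewrite /weyl_cube /weyl_sqr.
case: n => [|n]; weyl_eval rel; lincomb F W.
Qed.

Lemma ope_omega_cubeS : ope (weyl_omega ap am) (weyl_cube am)
  [:: vder (weyl_cube am); (3 / 2) *: weyl_cube am].
Proof.
move=> n; rewrite /weyl_cube /weyl_sqr.
case: n => [|[|n]]; weyl_eval rel; lincomb F W.
Qed.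

End WeylOPE.

Section WeylBP.
Variables (F : numFieldType) (W : vertexAlgebra F).

Lemma ope_scale (c d : F) (a b : W) cs cs' :
  ope a b cs -> [seq (c * d) *: x | x <- cs] = cs' -> ope (c *: a) (d *: b) cs'.
Proof.
move=> h <- n; rewrite vmulZl vmulZr scalerA h.
have [ns|ns] := ltnP n (size cs); first by rewrite (nth_map 0).
by rewrite !nth_default ?size_map // scaler0.
Qed.

Variables ap am : W.
Hypothesis rel : weyl_relations ap am.

Lemma weyl_bpE : weyl_bp ap am = BPFields (- (1 / 3) *: weyl_jj ap am)
  (1 *: weyl_omega ap am) ((1 / 3) *: weyl_cube ap) ((1 / 9) *: weyl_cube am).
Proof. by rewrite scale1r. Qed.

(** At this level c_k = -1 and (2k + 3)/3 = -1/9, the constants produced by omega and by -1/3 of the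
    quadratic vector. *)
Lemma weyl_bp_relations : bp_relations (- (5 / 3)) (weyl_bp ap am).
Proof.
rewrite weyl_bpE /bp_relations; split; [|split|split|split; [|split| |]].
- apply: (ope_scale (ope_jj_jj rel)); rewrite /=; congr [:: _; _]; lincomb F W.
- exact: (ope_scale (ope_cube_cube rel)).
- exact: (ope_scale (ope_cube_cube (weyl_swap rel))).
- apply: (ope_scale (ope_jj_cube rel)); rewrite /=; congr [:: _]; lincomb F W.
- apply: (ope_scale (ope_jj_cubeS rel)); rewrite /=; congr [:: _]; lincomb F W.
- apply: (ope_scale (ope_omega_omega rel)); rewrite /=.
  rewrite !vderZ /bp_charge; congr [:: _; _; _; _]; lincomb F W.
- apply: (ope_scale (ope_omega_cube rel)); rewrite /=.
  rewrite !vderZ; congr [:: _; _]; lincomb F W.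
- apply: (ope_scale (ope_omega_cubeS rel)); rewrite /=.
  rewrite !vderZ; congr [:: _; _]; lincomb F W.
- apply: (ope_scale (ope_omega_jj rel)); rewrite /=.
  rewrite !vderZ; congr [:: _; _]; lincomb F W.
- apply: (ope_scale (ope_cube_cubeS rel)); rewrite /=.
  rewrite !vderZ !vmulZl !vmulZr; congr [:: _; _; _]; lincomb F W.
Qed.

End WeylBP.
(** * Irreducibility *)

Lemma full_setP (T : Type) (P : set T) : P = setT -> forall v, P v.
Proof. by move=> ->. Qed.

(** A generator of weight (h + 1)/2 has creation modes of weight n + (h + 1)/2 > 0, so every
    nonempty creation monomial is an eigenvector of positive weight. *)
Lemma strongly_generated_graded (F : numFieldType) (V : vertexAlgebra F) (X : set V)
    (E : V -> V) : linear E -> E vac = 0 -> strongly_generated X ->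
  (forall x, X x -> exists h : nat, forall (n : nat) v,
    E (x \_(- n.+1%:Z) v) = x \_(- n.+1%:Z) (E v)
      + (n%:R + h.+1%:R / 2) *: (x \_(- n.+1%:Z) v)) ->
  pos_graded E vac.
Proof.
move=> linE Ev sgX hX; split=> // P sP Pvac hP v.
pose K w := forall Q : set V, subspace Q -> Q vac ->
  (forall (d : nat) v, E v = (d.+1%:R / 2) *: v -> Q v) -> Q w.
suff /full_setP KT : K = setT :> set V by exact: KT.
move=> {v}; apply: sgX => //.
  split=> [Q sQ _ _|c x y Kx Ky Q sQ Qv hQ]; first exact: subspace0.
  by apply: subspace_lin => //; [exact: Kx | exact: Ky].
move=> x n v Xx Kv Q sQ Qvac hQ; have [h hE] := hX x Xx.
apply: (Kv [set u | Q (x \_(- n.+1%:Z) u)]); first exact: subspace_preim.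
  (* The index d encodes the weight (d + 1)/2, hence d = 2n + h for weight n + (h + 1)/2. In the
     next case the weight of [u] adds d + 1 to it. *)
  apply: (hQ (n.*2 + h)%N); rewrite hE Ev vmul0r add0r; congr (_ *: _).
  by rewrite -addnS natrD -muln2 natrM; by field.
move=> d u Eu /=; apply: (hQ (n.*2 + h + d.+1)%N).
rewrite hE Eu vmulZr -scalerDl; congr (_ *: _).
rewrite -addSn -addnS !natrD -muln2 natrM; by field.
Qed.

Section WeylModule.
Variables (F : numFieldType) (W : vertexAlgebra F) (ap am : W).
Hypothesis rel : weyl_relations ap am.
Hypothesis gen : generated [set y | y = ap \/ y = am].

Lemma weyl_graded : pos_graded (vmul (weyl_omega ap am) 1) vac.
Proof.
apply: (strongly_generated_graded _ _ (weyl_strongly_generated rel gen)).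
- exact: vmul_linearr.
- exact: vmul_vac_ge0.
move=> x hx; exists 0%N => n v.
have h : - (- n.+1%:~R + 1 / 2 : F) = n%:R + 1 / 2.
  by rewrite -pmulrn -addn1 natrD; by field.
case: hx => ->; rewrite ?omega_ap ?omega_am // addrK -scaleNr; congr (_ + _ *: _).
all: by rewrite rmorphN h.
Qed.

(** The vectors killed by every product of k annihilation modes. *)
Fixpoint weyl_nil (k : nat) : set W :=
  if k is k'.+1 then
    [set w | forall n : nat, weyl_nil k' (ap \_(n%:Z) w) /\ weyl_nil k' (am \_(n%:Z) w)]
  else [set 0].

Lemma weyl_nil_subspace k : subspace (weyl_nil k).
Proof.
elim: k => [|k IH] /=.
  by split=> // c x y -> ->; rewrite scaler0 addr0.
split=> [n|c x y hx hy n]; first by rewrite !vmul0r; split; exact: (subspace0 IH).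
have [px mx] := hx n; have [py my] := hy n.
by rewrite !vmulDr !vmulZr; split; exact: (subspace_lin IH).
Qed.

Lemma weyl_nilS k w : weyl_nil k w -> weyl_nil k.+1 w.
Proof.
elim: k w => [w -> n|k IH w hw n]; first by rewrite !vmul0r.
by have [h h'] := hw n; split; exact: IH.
Qed.

(** Moving an annihilation mode past the creation mode lowers the degree of [w] by one, and the
    contraction term is a multiple of [w] itself, so the bound rises by only one. *)
Lemma weyl_nil_crea k (n : nat) w : weyl_nil k w ->
  weyl_nil k.+1 (ap \_(- n.+1%:Z) w) /\ weyl_nil k.+1 (am \_(- n.+1%:Z) w).
Proof.
have s k' := weyl_nil_subspace k'.
elim: k w => [w ->|k IH w hw]; first by rewrite !vmul0r; split; exact: (subspace0 (s 1%N)).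
have H (m : nat) : (weyl_nil k.+1 (ap \_(m%:Z) (ap \_(- n.+1%:Z) w))
      /\ weyl_nil k.+1 (am \_(m%:Z) (ap \_(- n.+1%:Z) w)))
    /\ (weyl_nil k.+1 (ap \_(m%:Z) (am \_(- n.+1%:Z) w))
      /\ weyl_nil k.+1 (am \_(m%:Z) (am \_(- n.+1%:Z) w))).
  have [pm mm] := hw m; have [pp pm'] := IH _ pm; have [mp mm'] := IH _ mm.
  rewrite (ap_ap rel) (am_am rel) (ap_am rel) (am_ap rel); do 2!split=> //.
    by apply: (subspaceB (s _)) => //; case: ifP => // _; exact: (subspace0 (s k.+1)).
  by apply: (subspaceD (s _)) => //; case: ifP => // _; exact: (subspace0 (s k.+1)).
by split=> m; have [] := H m.
Qed.

Lemma weyl_locally_nilpotent w : exists k, weyl_nil k w.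
Proof.
move: w; apply: (full_setP (P := [set w | exists k, weyl_nil k w])).
have wn k l v : (k <= l)%N -> weyl_nil k v -> weyl_nil l v.
  move=> /subnK <-; elim: (l - k)%N => [//|m IH] /IH; rewrite addSn; exact: weyl_nilS.
apply: (weyl_strongly_generated rel gen).
- split=> [|c x y [k hk] [l hl]]; first by exists 0%N.
  exists (maxn k l); apply: (subspace_lin (weyl_nil_subspace _)).
    by apply: wn hk; rewrite leq_maxl.
  by apply: wn hl; rewrite leq_maxr.
- by exists 1%N => n; rewrite /= (ap_vac rel) ?(am_vac rel).
- by move=> x n v [->|->] [k hk]; exists k.+1; have [] := weyl_nil_crea n hk.
Qed.

(** In the iterate formula for omega_(1) each term applies an annihilation mode to [w] first. So [w]
    has weight 0, and the weight 0 space is the vacuum line. *)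
Lemma weyl_vacuum w : (forall n : nat, ap \_(n%:Z) w = 0 /\ am \_(n%:Z) w = 0) ->
  exists c, w = c *: vac.
Proof.
move=> hw; apply: (pos_graded_ker _ weyl_graded); first exact: vmul_linearr.
have iter0 (a b : W) : (forall n : nat, a \_(n%:Z) w = 0 /\ b \_(n%:Z) w = 0) ->
    (a \_(-2) (b \_(-1) vac)) \_(1) w = 0.
  move=> hab; rewrite vmul_vacN1; have [N /(_ N (leqnn _)) ->] := viterate a b (-2) 1 w.
  rewrite big1 // => j _; have [-> _] := hab j.
  rewrite (_ : 1 + j%:Z = j.+1%:Z) ?(hab _).2; last by lia.
  by rewrite !vmul0r scaler0 subr0 scaler0.
rewrite /weyl_omega vmulZl vmulDl vmulNl !iter0 ?subr0 ?scaler0 // => n.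
by have [] := hw n.
Qed.

(** Local nilpotency lets annihilation modes lead from [w] to a nonzero vector of [U] killed by all
    of them, hence to [vac]; creation modes then rebuild everything. *)
Lemma weyl_irreducible (U : set W) w : subspace U -> w != 0 -> U w ->
  (forall n v, U v -> U (ap \_(n) v) /\ U (am \_(n) v)) -> forall v, U v.
Proof.
move=> sU w0 Uw hU; suff Uvac : U vac.
  apply: full_setP; apply: (weyl_strongly_generated rel gen) => // x n v [->|->] Uv.
    exact: (hU _ _ Uv).1.
  exact: (hU _ _ Uv).2.
have [k hk] := weyl_locally_nilpotent w.
elim: k w w0 Uw hk => [w w0 _ e|k IH w w0 Uw hk]; first by rewrite e eqxx in w0.
have [h|] := pselect (forall n : nat, ap \_(n%:Z) w = 0 /\ am \_(n%:Z) w = 0).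
  have [c hc] := weyl_vacuum h; apply: (subspaceZK sU (c := c)); last by rewrite -hc.
  by apply: contra w0 => /eqP c0; rewrite hc c0 scale0r.
move/existsNP => [n /not_andP hn]; have [pn mn] := hk n; have [Upn Umn] := hU n%:Z _ Uw.
case: hn => /eqP h0; first exact: IH h0 Upn pn.
exact: IH h0 Umn mn.
Qed.

End WeylModule.

(** * Eigenspaces of g and minimality of stable subspaces *)

Section Grading3.
Variables (F : numFieldType) (M : lmodType F) (g : M -> M) (z : F).
Hypotheses (ling : linear g) (z3 : 1 + z + z ^+ 2 = 0).

(** The operator g^2 + mu g + mu^2 multiplies [u] by 3 mu^2 and kills [v] and [w], because both
    remaining coefficients contain the factor 1 + z + z^2. *)
Lemma eigen3_independent mu u v w : mu != 0 -> g u = mu *: u ->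
  g v = (z * mu) *: v -> g w = (z ^+ 2 * mu) *: w -> u + v + w = 0 -> u = 0.
Proof.
move=> mu0 gu gv gw e.
have gD x y : g (x + y) = g x + g y by have := ling 1 x y; rewrite !scale1r.
have gZ c x : g (c *: x) = c *: g x by exact: lin_funZ.
have g0 : g 0 = 0 by exact: lin_fun0.
have : g (g (u + v + w)) + mu *: g (u + v + w) + mu ^+ 2 *: (u + v + w) = 0.
  by rewrite e !g0 !scaler0 !addr0.
rewrite !(gD, gu, gv, gw, gZ).
have -> : (mu *: (mu *: u) + z * mu *: (z * mu *: v) + z ^+ 2 * mu *: (z ^+ 2 * mu *: w))
   + mu *: (mu *: u + z * mu *: v + z ^+ 2 * mu *: w) + mu ^+ 2 *: (u + v + w)
   = (3 * mu ^+ 2) *: u + ((1 + z + z ^+ 2) * mu ^+ 2) *: v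
     + ((1 + z + z ^+ 2) * (1 - z + z ^+ 2) * mu ^+ 2) *: w by lincomb F M.
rewrite z3 !mul0r !scale0r !addr0 => /eqP.
by rewrite scaler_eq0 mulf_eq0 pnatr_eq0 expf_eq0 (negbTE mu0) /= => /eqP.
Qed.

End Grading3.

Section WeylEigenspace.
Variables (F : numFieldType) (W : vertexAlgebra F) (ap am : W).
Hypothesis rel : weyl_relations ap am.
Hypothesis gen : generated [set y | y = ap \/ y = am].
Variables (g : W -> W) (z : F).
Hypotheses (ling : linear g) (z3 : 1 + z + z ^+ 2 = 0).
Hypothesis g_ap : forall m w, g (ap \_(m) w) = z *: (ap \_(m) (g w)).
Hypothesis g_am : forall m w, g (am \_(m) w) = z ^+ 2 *: (am \_(m) (g w)).

(* N together with the vectors that the Weyl modes bring back into N spans a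
   submodule for the whole Weyl algebra, hence everything. *)
Lemma weyl_eigenspace_minimal (N : set W) mu w :
  subspace N -> N `<=` [set v | g v = mu *: v] -> mu != 0 -> w != 0 -> N w ->
  (forall m n v, N v -> N (ap \_(m) (am \_(n) v))) ->
  (forall l m n v, N v -> N (ap \_(l) (ap \_(m) (ap \_(n) v)))) ->
  (forall l m n v, N v -> N (am \_(l) (am \_(m) (am \_(n) v)))) ->
  [set v | g v = mu *: v] `<=` N.
Proof.
move=> sN Nmu mu0 w0 Nw hpm hppp hmmm.
have hmp m n v : N v -> N (am \_(m) (ap \_(n) v)).
  move=> Nv; rewrite (am_ap rel); apply: (subspaceB sN); first exact: hpm.
  by case: ifP => // _; exact: subspace0.
have gZ c x : g (c *: x) = c *: g x by exact: lin_funZ.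
have z4 : z ^+ 2 * z ^+ 2 = z.
  apply/eqP; rewrite -subr_eq0.
  have -> : z ^+ 2 * z ^+ 2 - z = (1 + z + z ^+ 2) * (z ^+ 2 - z) by ring.
  by rewrite z3 mul0r.
(* [N1] and [N2] lie in the eigenspaces of z mu and z^2 mu. Their conditions say that the shortest
   products of modes returning to the eigenvalue mu, namely a- or a+ a+ from [N1], and a+ or a- a-
   from [N2], end in [N]. *)
pose N1 : set W := [set v | [/\ g v = (z * mu) *: v, forall n, N (am \_(n) v)
  & forall m n, N (ap \_(m) (ap \_(n) v))]].
pose N2 : set W := [set v | [/\ g v = (z ^+ 2 * mu) *: v, forall n, N (ap \_(n) v)
  & forall m n, N (am \_(m) (am \_(n) v))]].
have g_lin c x y nu : g x = nu *: x -> g y = nu *: y -> g (c *: x + y) = nu *: (c *: x + y).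
  by move=> gx gy; rewrite ling gx gy; lincomb F W.
have sN1 : subspace N1.
  split; first by split=> *; rewrite ?vmul0r ?scaler0 ?(lin_fun0 ling) //; exact: subspace0.
  move=> c x y [gx mx px] [gy my py]; split; first exact: g_lin.
    by move=> n; rewrite vmulDr vmulZr; exact: subspace_lin.
  by move=> m n; rewrite !vmulDr !vmulZr; exact: subspace_lin.
have sN2 : subspace N2.
  split; first by split=> *; rewrite ?vmul0r ?scaler0 ?(lin_fun0 ling) //; exact: subspace0.
  move=> c x y [gx mx px] [gy my py]; split; first exact: g_lin.
    by move=> n; rewrite vmulDr vmulZr; exact: subspace_lin.
  by move=> m n; rewrite !vmulDr !vmulZr; exact: subspace_lin.
pose U : set W := [set u | exists a b c, [/\ N a, N1 b, N2 c & u = a + b + c]].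
have sU : subspace U.
  split.
    by exists 0, 0, 0; split; rewrite ?addr0 //; exact: subspace0.
  move=> k x y [a [b [c [Na Nb Nc ->]]]] [a' [b' [c' [Na' Nb' Nc' ->]]]].
  exists (k *: a + a'), (k *: b + b'), (k *: c + c').
  by split; [exact: subspace_lin | exact: subspace_lin | exact: subspace_lin | lincomb F W].
(* Modes of a+ send [N] to [N1], [N1] to [N2] and [N2] to [N]; modes of a- go round the cycle the
   other way. *)
have hU n v : U v -> U (ap \_(n) v) /\ U (am \_(n) v).
  move=> [a [b [c [Na [gb mb pb] [gc pc mc] ->]]]]; have ga := Nmu _ Na.
  rewrite !vmulDr; split.
    exists (ap \_(n) c), (ap \_(n) a), (ap \_(n) b).
    split; [exact: pc | split=> [|k|k l] | split=> [|k|k l] | by lincomb F W].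
    - by rewrite g_ap ga vmulZr scalerA.
    - exact: hmp.
    - exact: hppp.
    - by rewrite g_ap gb vmulZr !scalerA mulrA -expr2.
    - exact: pb.
    - rewrite [am \_(l) _](am_ap rel) vmulDr vmulNr.
      apply: (subspaceB sN); first exact/hmp/mb.
      by case: ifP => _; rewrite ?vmul0r; [exact: mb | exact: subspace0].
  exists (am \_(n) b), (am \_(n) c), (am \_(n) a).
  split; [exact: mb | split=> [|k|k l] | split=> [|k|k l] | by lincomb F W].
  - by rewrite g_am gc vmulZr !scalerA mulrA z4.
  - exact: mc.
  - rewrite [ap \_(l) _](ap_am rel) vmulDr.
    apply: (subspaceD sN); first exact/hpm/pc.
    by case: ifP => _; rewrite ?vmul0r; [exact: pc | exact: subspace0].
  - by rewrite g_am ga vmulZr scalerA.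
  - exact: hpm.
  - exact: hmmm.
have Uw : U w by exists w, 0, 0; rewrite !addr0; split=> //; exact: subspace0.
move=> v /= gv; have [a [b [c [Na [gb _ _] [gc _ _] ev]]]] := weyl_irreducible rel gen sU w0 Uw hU v.
(* With [v] in the eigenspace of mu, independence of the three eigenspaces forces v = a, which lies
   in [N]. *)
have e : (a - v) + b + c = 0 by rewrite ev; lincomb F W.
have gav : g (a - v) = mu *: (a - v).
  have ga : g a = mu *: a := Nmu _ Na.
  by rewrite addrC -scaleN1r ling ga gv; lincomb F W.
have /eqP := eigen3_independent ling z3 mu0 gav gb gc e.
by rewrite subr_eq0 => /eqP <-.
Qed.

End WeylEigenspace.

(** * Quadratic and cubic vectors generated by the Bershadsky-Polyakov fields *)

Section Generation.
Variables (F : numFieldType) (W : vertexAlgebra F) (ap am : W).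
Hypothesis rel : weyl_relations ap am.

(* All vectors on the right come from J, T, G+ and G-; they span
   the six-dimensional space of charge 0 and weight 3. *)
Lemma weyl_weight3 :
  84 *: (ap \_(-3) (am \_(-1) vac)) =
    weyl_cube ap \_(-1) weyl_cube am
    - weyl_jj ap am \_(-1) (weyl_jj ap am \_(-1) weyl_jj ap am)
    - 21 *: (weyl_jj ap am \_(-1) (ap \_(-2) (am \_(-1) vac)))
    + 3 *: (weyl_jj ap am \_(-1) (ap \_(-1) (am \_(-2) vac)))
    + 23 *: vder (ap \_(-2) (am \_(-1) vac)) - vder (ap \_(-1) (am \_(-2) vac)).
Proof.
have jj_vac : weyl_jj ap am \_(Negz 0) vac = ap \_(Negz 0) (am \_(Negz 0) vac).
  exact: vmul_vacN1.
have sqr_vac : weyl_sqr ap \_(Negz 1) vac = 2 *: (ap \_(Negz 1) (ap \_(Negz 0) vac)).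
  rewrite -/(vder _) !(vder_ap ap 0) vder_vac !vmul_lin; eval_modes.
  by rewrite (ap_ap rel (Negz 0)); lincomb F W.
have cube_vac : weyl_cube ap \_(Negz 0) vac = ap \_(Negz 0) (ap \_(Negz 0) (ap \_(Negz 0) vac)).
  exact: vmul_vacN1.
rewrite [X in _ - (_ \_(_) (_ \_(_) X))]/weyl_jj [weyl_cube am]/weyl_cube /weyl_sqr.
eval_modes; repeat (rewrite !(jj_vac, sqr_vac, cube_vac, weyl_rules rel); eval_modes).
rewrite !(ap_ap rel (Negz 0) (Negz 1)) !(am_am rel (Negz 0) (Negz 1)).
lincomb F W.
Qed.

(** Here a+ contracts only with a-_(-1), at j = 0, which leaves a+_(-3) vac, that is, half the
    second derivative of a+. *)
Lemma weight3_ap m w : (ap \_(-3) (am \_(-1) vac)) \_(1) (ap \_(m) w) =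
  ap \_(m) ((ap \_(-3) (am \_(-1) vac)) \_(1) w) - ((m + 1) * m)%:~R / 2 *: (ap \_(m - 1) w).
Proof.
have h j : ap \_(j%:Z) (ap \_(-3) (am \_(-1) vac)) = if j == 0%N then (1 / 2) *: vder (vder ap) else 0.
  rewrite vmul_vacN1 (ap_ap rel) (ap_am_ge0 rel); case: j => [|j] /=; last by rewrite vmul0r.
  by rewrite [vder ap](_ : _ = ap \_(Negz 1) vac) // vder_ap vder_vac vmul0r; eval_modes; lincomb F W.
rewrite [in RHS]vcomm1 => [|j]; last by rewrite h.
rewrite (h 0%N) vmulZl !vderl (_ : m + 1 - 1 - 1 = m - 1); last by lia.
rewrite !rmorphM !rmorphB !rmorphD /= !rmorph1; lincomb F W.
Qed.

(** Here a- contracts only with a+_(-3), at j = 2, hence the binomial coefficient m(m - 1)/2. *)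
Lemma weight3_am m w : (ap \_(-3) (am \_(-1) vac)) \_(1) (am \_(m) w) =
  am \_(m) ((ap \_(-3) (am \_(-1) vac)) \_(1) w) + (m * (m - 1))%:~R / 2 *: (am \_(m - 1) w).
Proof.
have h j : am \_(j%:Z) (ap \_(-3) (am \_(-1) vac)) = if j == 2%N then - am else 0.
  rewrite vmul_vacN1 (am_ap rel) (am_am_ge0 rel) vmul0r sub0r.
  have -> : (j%:Z - 3 + 1 == 0) = (j == 2%N) by lia.
  by case: ifP => // _; rewrite oppr0.
rewrite [in RHS](vcomm (K := 3)); last by move=> [|[|[|j]]] // _; rewrite h.
rewrite !big_ord_recl big_ord0 /= (h 0%N) (h 1%N) (h 2%N) /= !vmul0l vmulNl binz2.
rewrite (_ : m + 1 - 2%:Z = m - 1); last by lia.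
rewrite !rmorphM !rmorphB /= !rmorph1; lincomb F W.
Qed.

(** Mode 1 of a weight 3 vector raises the weight by one. Modulo the derivative it produces the next
    quadratic vector with a nonzero coefficient, which drives the induction on n. *)
Lemma weight3_quadratic (n : nat) :
  (ap \_(-3) (am \_(-1) vac)) \_(1) (ap \_(Negz n) (am \_(-1) vac)) =
    vder (ap \_(Negz n) (am \_(-1) vac))
    - (n.+1%:R * n.+2%:R / 2) *: (ap \_(Negz n.+1) (am \_(-1) vac)).
Proof.
rewrite weight3_ap weight3_am vmul_vac_ge0 // vder_ap (vder_am am 0) vder_vac.
rewrite (_ : Negz n - 1 = Negz n.+1); last by lia.
rewrite (_ : (Negz n + 1) * Negz n = (n * n.+1)%N%:Z); last by lia.
rewrite (_ : -1 * (-1 - 1) = 2%:Z :> int) // -!pmulrn natrM !vmul_lin.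
eval_modes; rewrite -addn2 -[n.+1]addn1 !natrD; lincomb F W.
Qed.

Section Subalgebra.
Variable A : set W.
Hypothesis subA : vsubalgebra A.
Hypotheses (A_jj : A (weyl_jj ap am)) (A_omega : A (weyl_omega ap am)).
Hypotheses (A_cube : A (weyl_cube ap)) (A_cubeS : A (weyl_cube am)).

(** The derivative of the vector [weyl_jj] and omega are the sum and half the difference of the two
    weight 2 vectors, so both lie in [A]. Then [weyl_weight3] supplies a+_(-3) a- and
    [weight3_quadratic] all later ones. *)
Lemma subalgebra_quadratic m : A (ap \_(m) am).
Proof.
have [sA Avac Amul] := subA.
have Ader a : A a -> A (vder a) by move=> Aa; exact: Amul.
have [m0|m0] := lerP 0 m.
  rewrite -[m]gez0_abs // (ap_am_ge0 rel); case: ifP => // _; exact: subspace0.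
have At : A (ap \_(-2) (am \_(-1) vac)).
  have -> : ap \_(-2) (am \_(-1) vac) = (1 / 2) *: vder (weyl_jj ap am) - weyl_omega ap am.
    rewrite /weyl_jj /weyl_omega (vder_ap ap 0) (vder_am am 0) vder_vac !vmul_lin.
    by rewrite (am_ap_crea rel 1 0); eval_modes; lincomb F W.
  by apply: (subspaceB sA) => //; apply: (subspaceZ sA); exact: Ader.
have At' : A (ap \_(-1) (am \_(-2) vac)).
  have -> : ap \_(-1) (am \_(-2) vac) = (1 / 2) *: vder (weyl_jj ap am) + weyl_omega ap am.
    rewrite /weyl_jj /weyl_omega (vder_ap ap 0) (vder_am am 0) vder_vac !vmul_lin.
    by rewrite (am_ap_crea rel 1 0); eval_modes; lincomb F W.
  by apply: (subspaceD sA) => //; apply: (subspaceZ sA); exact: Ader.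
have A2 : A (ap \_(-3) (am \_(-1) vac)).
  apply: (subspaceZK sA (c := 84)); first by rewrite pnatr_eq0.
  rewrite weyl_weight3.
  apply: (subspaceB sA); last exact: Ader.
  apply: (subspaceD sA); last by apply: (subspaceZ sA); exact: Ader.
  apply: (subspaceD sA); last by apply: (subspaceZ sA); exact: Amul.
  apply: (subspaceB sA); last by apply: (subspaceZ sA); exact: Amul.
  by apply: (subspaceB sA); [exact: Amul | apply: (Amul) => //; exact: Amul].
have An n : A (ap \_(Negz n) (am \_(-1) vac)).
  elim: n => [//|n IH].
  apply: (subspaceZK sA (c := n.+1%:R * n.+2%:R / 2)).
    by rewrite !mulf_neq0 // ?invr_eq0 pnatr_eq0.
  have -> : (n.+1%:R * n.+2%:R / 2) *: (ap \_(Negz n.+1) (am \_(-1) vac)) =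
      vder (ap \_(Negz n) (am \_(-1) vac))
      - (ap \_(-3) (am \_(-1) vac)) \_(1) (ap \_(Negz n) (am \_(-1) vac)).
    by rewrite weight3_quadratic; lincomb F W.
  by apply: (subspaceB sA); [exact: Ader | exact: Amul].
by rewrite -[am]vmul_vacN1 (_ : m = Negz (`|m|%N.-1)); [exact: An | lia].
Qed.

End Subalgebra.

(** The mode a-_(0) removes one factor of (a+)^3, and the pair a+_(l) a-_(0) therefore replaces a
    factor by a+_(l). Doing this twice places both indices. *)
Lemma cubic_of_pairs (A : set W) l m : subspace A ->
  A (weyl_cube ap) -> (forall m n w, A w -> A (ap \_(m) (am \_(n) w))) ->
  A (ap \_(l) (ap \_(m) ap)).
Proof.
move=> sA Ac hA.
have A1 k : A (ap \_(k) (weyl_sqr ap)).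
  apply: (subspaceZK sA (c := - 3)); first by rewrite oppr_eq0 pnatr_eq0.
  by have := hA k 0 _ Ac; rewrite (am_cube rel 0) vmulZr.
apply: (subspaceZK sA (c := - 2)); first by rewrite oppr_eq0 pnatr_eq0.
(* For m = -1 the mode a-_(0) also contracts with a+_(m); the extra term is of the form treated in
   [A1]. *)
have := hA l 0 _ (A1 m); rewrite (am_ap rel) (am_sqr rel 0) vmulZr vmulDr vmulZr vmulNr => h.
rewrite -[_ *: _](subrK (ap \_(l) (if 0 + m + 1 == 0 then weyl_sqr ap else 0))).
apply: (subspaceD sA) => //; case: ifP => _; first exact: A1.
by rewrite vmul0r; exact: subspace0.
Qed.

(** Two uses of associativity: the first merges the two inner modes into modes of a quadratic
    vector, the second merges the outer mode with these. *)
Lemma cubic_stable (N : set W) : subspace N ->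
  (forall l m k w, N w -> N ((ap \_(l) (ap \_(m) ap)) \_(k) w)) ->
  forall l m n w, N w -> N (ap \_(l) (ap \_(m) (ap \_(n) w))).
Proof.
move=> sN hN l m n w Nw.
apply: (assoc_span (P := [set u | N (ap \_(l) u)])); first exact: subspace_preim.
by move=> i j; apply: (assoc_span sN) => i' j'; exact: hN.
Qed.

End Generation.
(** * The automorphism g *)

Import numFieldNormedType.Exports.

Lemma cvg_lincomb (K : numFieldType) (c : K) (u v : nat -> K^o) (a b : K^o) :
  u @ \oo --> a -> v @ \oo --> b ->
  (fun n => c * u n + v n : K^o) @ \oo --> (c * a + b : K^o).
Proof. by move=> ua vb; apply: cvgD => //; apply: cvgM => //; exact: cvg_cst. Qed.

Section ComplexExponential.
Variable R : realType.
Implicit Types (x y : R[i]) (t : R).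

Lemma cexpD x y : cexp (x + y) = cexp x * cexp y.
Proof.
case: x y => [a b] [c d]; rewrite /cexp /= expRD cosD sinD.
by apply/eqP; rewrite eq_complex /=; apply/andP; split; apply/eqP; ring.
Qed.

Lemma cexp0 : cexp (0 : R[i]) = 1.
Proof. by rewrite /cexp /= expR0 cos0 sin0 mulr1 mulr0. Qed.

Lemma cexp_two_pi_i : cexp (two_pi_i R) = 1.
Proof. by rewrite /cexp /two_pi_i expR0 mulr_natl cos2pi sin2pi mulr1 mulr0. Qed.

(** Stated in the shape of [cos_coeff] and [sin_coeff], so that the partial sums of the exponential
    split into their series. *)
Lemma imaginaryX t n : (0 +i* t) ^+ n =
  ((~~ odd n)%:R * (-1) ^+ n./2 * t ^+ n) +i* ((odd n)%:R * (-1) ^+ n.-1./2 * t ^+ n).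
Proof.
elim: n => [|n IH]; first by rewrite !expr0 /= !mul1r !mul0r.
rewrite exprSr IH; apply/eqP; rewrite eq_complex /= !mulr0 ?add0r ?addr0 ?sub0r.
rewrite exprSr /= uphalf_half; case: n {IH} => [|n]; first by rewrite /= !mul0r !mul1r !oppr0 !eqxx.
rewrite /= uphalf_half; case: (odd n) => /=.
  by rewrite !mul0r !mul1r add1n /= !mulrA ?oppr0 !eqxx.
by rewrite !add0n add1n [(-1) ^+ _.+1]exprS; apply/andP; split; apply/eqP; ring.
Qed.

Lemma exp_partial_sum t N :
  \sum_(n < N) (0 +i* t) ^+ n / n`!%:R = series (cos_coeff t) N +i* series (sin_coeff t) N.
Proof.
elim: N => [|N IH]; first by rewrite big_ord0 /series /= !big_geq.
rewrite big_ord_recr /= IH imaginaryX /series /= !big_nat_recr //=.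
have -> : (N`!%:R : R[i]) = N`!%:R%:C by rewrite rmorph_nat.
rewrite -fmorphV; apply/eqP; rewrite eq_complex /= !mulr0 subr0 add0r.
by apply/andP; split; apply/eqP; congr (_ + _); ring.
Qed.

Lemma cvg_complex (u v : nat -> R) (a b : R) :
  u @ \oo --> a -> v @ \oo --> b ->
  (fun n => u n +i* v n : R[i]^o) @ \oo --> (a +i* b : R[i]^o).
Proof.
move=> ua vb; apply/cvgrPdist_le => e e0.
(* A positive element of R[i] is a positive real, and half of it bounds each of the real and
   imaginary parts. *)
have [r r0 re] : exists2 r : R, 0 < r & (r + r)%:C <= e.
  case: e e0 => x y; rewrite ltcE /= => /andP[/eqP -> x0]; exists (x / 2).
    by rewrite divr_gt0.
  by rewrite -splitr lecE /= eqxx lexx.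
near=> n; apply: le_trans re.
have -> : (a +i* b : R[i]^o) - (u n +i* v n) = (a - u n) +i* (b - v n) by [].
rewrite normc_def /= lecR.
apply: (@le_trans _ _ (`|a - u n| + `|b - v n|)).
  rewrite -[leRHS]ger0_norm ?addr_ge0 // -sqrtr_sqr ler_sqrt ?sqr_ge0 //.
  rewrite [leRHS]sqrrD !real_normK ?num_real // addrAC lerDl.
  by rewrite mulrn_wge0 // mulr_ge0.
apply: lerD; near: n.
  by have /cvgrPdist_le := ua; apply.
by have /cvgrPdist_le := vb; apply.
Unshelve. all: by end_near. Qed.

Lemma cvg_exp_imaginary t :
  (fun N => \sum_(n < N) (0 +i* t) ^+ n / n`!%:R : R[i]^o) @ \oo
    --> (cexp (0 +i* t) : R[i]^o).
Proof.
rewrite (_ : (fun N => _) =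
    (fun N => series (cos_coeff t) N +i* series (sin_coeff t) N : R[i]^o)); last first.
  by apply/funext => N; rewrite exp_partial_sum.
rewrite /cexp expR0 !mul1r; apply: cvg_complex.
  by rewrite cos.unlock; exact: is_cvg_series_cos_coeff.
by rewrite sin.unlock; exact: is_cvg_series_sin_coeff.
Qed.

(** The vectors on which the series converges against [f] form a subspace, so eigenvectors suffice.
    There it is a scalar exponential series at a purely imaginary point. *)
Lemma op_exp_of_eigen (M : lmodType R[i]) (E g : M -> M) (L : set R[i]) :
  linear E -> linear g -> diagonalizable E L ->
  (forall l v, L l -> E v = l *: v -> exists t, two_pi_i R * l = 0 +i* t
     /\ g v = cexp (0 +i* t) *: v) ->
  op_exp (fun v => two_pi_i R *: E v) g.
Proof.
move=> linE ling dE hg f; apply: dE.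
  split=> [|c x y hx hy].
    rewrite (lin_fun0 ling) linear0 (_ : (fun N => _) = (fun=> 0)); first exact: cvg_cst.
    apply/funext => N; rewrite big1 // => n _.
    by rewrite (_ : iter _ _ _ = 0) ?linear0 ?mul0r //;
      elim: (n : nat) => //= m ->; rewrite (lin_fun0 linE) scaler0.
  rewrite ling linearP /=.
  have := cvg_lincomb (c := c) hx hy; apply: cvg_trans; apply: near_eq_cvg.
  apply: nearW => N /=; rewrite mulr_sumr -big_split /=; apply: eq_bigr => n _.
  rewrite (_ : iter n _ (c *: x + y) = c *: iter n (fun v => two_pi_i R *: E v) x
    + iter n (fun v => two_pi_i R *: E v) y).
    by rewrite linearP /= [in RHS]mulrDl -mulrA.
  by elim: (n : nat) => //= m ->; rewrite linE scalerDr !scalerA mulrC.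
move=> l v Ll Ev; have [t [et gv]] := hg l v Ll Ev.
rewrite gv (_ : f _ = cexp (0 +i* t) * f v); last by rewrite linearZ.
have cvg0 : (fun _ : nat => 0 : R[i]^o) @ \oo --> (0 : R[i]^o) by exact: cvg_cst.
have := cvg_lincomb (c := f v) (@cvg_exp_imaginary t) cvg0.
rewrite [f v * cexp _]mulrC addr0; apply: cvg_trans; apply: near_eq_cvg.
apply: nearW => N /=; rewrite addr0 mulr_sumr; apply: eq_bigr => n _.
rewrite (_ : iter n _ v = (0 +i* t) ^+ n *: v).
  by rewrite linearZ /= mulrA [f v * _]mulrC.
elim: (n : nat) => [|m IH]; first by rewrite expr0 scale1r.
by rewrite iterS IH (lin_funZ linE) Ev !scalerA exprSr -et; congr (_ *: _); ring.
Qed.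

End ComplexExponential.

(** * Exponentiating a zero mode to an automorphism *)

Section ZeroMode.
Variables (F : numFieldType) (V : vertexAlgebra F) (J : V).

(** As J_(0) is a derivation, products of eigenvectors are eigenvectors for the sum of the
    eigenvalues; the span of eigenvectors is thus a subalgebra. *)
Lemma zero_mode_diagonalizable (L : set F) (X : set V) :
  L 0 -> (forall l m, L l -> L m -> L (l + m)) -> generated X ->
  (forall x, X x -> exists2 l, L l & J \_(0) x = l *: x) ->
  diagonalizable (vmul J 0) L.
Proof.
move=> L0 LD gX hX P sP hP; apply: full_setP.
pose K w := forall Q : set V, subspace Q ->
  (forall l v, L l -> J \_(0) v = l *: v -> Q v) -> Q w.
suff /full_setP KT : K = setT :> set V by apply/seteqP; split=> // v _; exact: KT.
apply: gX; last by move=> x /hX[l Ll Jx] Q sQ hQ; exact: hQ Ll Jx.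
split.
- split=> [Q sQ _|c x y Kx Ky Q sQ hQ]; first exact: subspace0.
  by apply: subspace_lin => //; [exact: Kx | exact: Ky].
- by move=> Q sQ hQ; apply: (hQ 0) => //; rewrite vmul_vac_ge0 // scale0r.
- move=> a b n Ka Kb Q sQ hQ; apply: (Ka [set a | Q (a \_(n) b)]).
    split=> [|c x y /= Qx Qy]; first by rewrite /= vmul0l; exact: subspace0.
    by rewrite vmulDl vmulZl; exact: subspace_lin.
  move=> l a' Ll Ja; apply: (Kb [set b | Q (a' \_(n) b)]); first exact: subspace_preim.
  move=> m b' Lm Jb; apply: (hQ (l + m)); first exact: LD.
  by rewrite vcomm_0 Ja Jb vmulZl vmulZr scalerDl.
Qed.

Variable L : set F.
Hypothesis diagJ : diagonalizable (vmul J 0) L.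
Variable chi : F -> F.
Hypotheses (chi0 : chi 0 = 1) (chiD : forall l m, chi (l + m) = chi l * chi m).

(** Both sides are bilinear, so eigenvectors suffice: their eigenvalues add, and [chi] turns sums
    into products. *)
Lemma fcalc_zero_mode_mul a n b :
  fcalc (vmul J 0) chi (a \_(n) b)
    = fcalc (vmul J 0) chi a \_(n) fcalc (vmul J 0) chi b.
Proof.
have lJ : linear (vmul J 0) by exact: vmul_linearr.
have lg := fcalc_linear lJ diagJ chi.
move: a; apply: (diagonalizable_eq diagJ).
- by move=> c x y; rewrite vmulDl vmulZl lg.
- by move=> c x y; rewrite lg vmulDl vmulZl.
move=> l a Ll Ja; move: b; apply: (diagonalizable_eq diagJ).
- by move=> c x y; rewrite vmulDr vmulZr lg.
- by move=> c x y; rewrite lg vmulDr vmulZr.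
move=> m b Lm Jb; rewrite (fcalc_eigen lJ diagJ _ Ja) (fcalc_eigen lJ diagJ _ Jb).
rewrite (fcalc_eigen lJ diagJ _ (l := l + m)) ?chiD ?vmulZl ?vmulZr ?scalerA //.
by rewrite vcomm_0 Ja Jb vmulZl vmulZr scalerDl.
Qed.

Lemma fcalc_zero_mode_vac : fcalc (vmul J 0) chi vac = vac.
Proof.
have lJ : linear (vmul J 0) by exact: vmul_linearr.
by rewrite (fcalc_eigen lJ diagJ _ (l := 0)) ?chi0 ?scale1r // vmul_vac_ge0 // scale0r.
Qed.

End ZeroMode.

Section Grading3Sum.
Variables (F : numFieldType) (M : lmodType F) (g : M -> M) (z : F).
Hypotheses (ling : linear g) (z3 : 1 + z + z ^+ 2 = 0) (g3 : forall v, g (g (g v)) = v).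

Lemma eigenspace_subspace mu : subspace [set v | g v = mu *: v].
Proof.
split=> [|c x y /= gx gy]; first by rewrite /= (lin_fun0 ling) scaler0.
by rewrite ling gx gy; lincomb F M.
Qed.

(** The components of v are the averages of z^(-ij) g^i v over i = 0, 1, 2, with z^(-1) = z^2. *)
Lemma direct_sum3_eigen :
  direct_sum3 [set v | g v = v] [set v | g v = z *: v] [set v | g v = z ^+ 2 *: v].
Proof.
have zz : z ^+ 2 = - (1 + z) by apply/eqP; rewrite -addr_eq0 addrC z3.
have z1 : z * z ^+ 2 = 1.
  apply/eqP; rewrite -subr_eq0.
  have -> : z * z ^+ 2 - 1 = (1 + z + z ^+ 2) * (z - 1) by ring.
  by rewrite z3 mul0r.
have z0 : z != 0 by apply/eqP => e; have := z1; rewrite e mul0r => /esym/eqP; rewrite oner_eq0.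
have gD x y : g (x + y) = g x + g y by have := ling 1 x y; rewrite !scale1r.
have gZ c x : g (c *: x) = c *: g x by exact: lin_funZ.
have s1 : subspace [set v | g v = v].
  have := eigenspace_subspace 1; congr subspace.
  by apply/seteqP; split=> v /=; rewrite scale1r.
split=> //; [exact: eigenspace_subspace | exact: eigenspace_subspace|].
move=> v.
have E0 : g ((1 / 3) *: (v + g v + g (g v))) = (1 / 3) *: (v + g v + g (g v)).
  by rewrite gZ !gD g3; lincomb F M.
have E1 : g ((1 / 3) *: (v + z ^+ 2 *: g v + z *: g (g v)))
    = z *: ((1 / 3) *: (v + z ^+ 2 *: g v + z *: g (g v))).
  (* The intermediate form isolates [z * z ^+ 2], which [z1] replaces by 1; what is left needs no
     relation on z. *)
  rewrite gZ !gD !gZ g3; transitivity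
    ((1 / 3) *: (z *: v + (z * z ^+ 2) *: g v + z ^+ 2 *: g (g v))); last by lincomb F M.
  by rewrite z1; lincomb F M.
have E2 : g ((1 / 3) *: (v + z *: g v + z ^+ 2 *: g (g v)))
    = z ^+ 2 *: ((1 / 3) *: (v + z *: g v + z ^+ 2 *: g (g v))).
  rewrite gZ !gD !gZ g3; transitivity
    ((1 / 3) *: (z ^+ 2 *: v + (z * z ^+ 2) *: g v + (z * (z * z ^+ 2)) *: g (g v)));
    last by lincomb F M.
  by rewrite z1; lincomb F M.
have Ev : v = (1 / 3) *: (v + g v + g (g v)) + (1 / 3) *: (v + z ^+ 2 *: g v + z *: g (g v))
    + (1 / 3) *: (v + z *: g v + z ^+ 2 *: g (g v)).
  by rewrite zz; lincomb F M.
exists ((1 / 3) *: (v + g v + g (g v)),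
  (1 / 3) *: (v + z ^+ 2 *: g v + z *: g (g v)),
  (1 / 3) *: (v + z *: g v + z ^+ 2 *: g (g v))); split; first by split.
move=> [[a b] c] /= [ga gb gc ev].
set p0 := _ *: (v + g v + _); set p1 := _ *: (v + z ^+ 2 *: _ + _).
set p2 := _ *: (v + z *: _ + _); rewrite -/p0 -/p1 -/p2 in E0 E1 E2 Ev *.
have B mu x y : g x = mu *: x -> g y = mu *: y -> g (x - y) = mu *: (x - y).
  by move=> gx gy; rewrite -scaleN1r gD gZ gx gy; lincomb F M.
have h : (p0 - a) + (p1 - b) + (p2 - c) = 0.
  have -> : p0 - a + (p1 - b) + (p2 - c) = (p0 + p1 + p2) - (a + b + c) by lincomb F M.
  by rewrite -Ev -ev subrr.
have h0 : g (p0 - a) = 1 *: (p0 - a) by apply: B; rewrite scale1r.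
have h1 := B _ _ _ E1 gb; have h2 := B _ _ _ E2 gc.
congr (_, _, _); apply/eqP; rewrite -subr_eq0; apply/eqP.
- apply: (eigen3_independent ling z3 (oner_neq0 _) h0 _ _ h); first by rewrite mulr1.
  by rewrite mulr1.
(* The roles rotate: with mu = z, the eigenvalues z mu and z^2 mu are z^2 and 1. *)
- apply: (eigen3_independent ling z3 z0 h1 (v := p2 - c) (w := p0 - a)).
  + by rewrite -expr2.
  + by rewrite mulrC z1.
  + by rewrite -h; lincomb F M.
- apply: (eigen3_independent ling z3 (expf_neq0 2 z0) h2 (v := p0 - a) (w := p1 - b)).
  + by rewrite z1.
  + by rewrite expr2 -mulrA -expr2 z1 mulr1.
  + by rewrite -h; lincomb F M.
Qed.

End Grading3Sum.
Section SubalgebraModules.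
Variables (F : numFieldType) (W : vertexAlgebra F) (ap am : W).
Hypothesis rel : weyl_relations ap am.
Hypothesis gen : generated [set y | y = ap \/ y = am].
Variables (g : W -> W) (z : F).
Hypotheses (ling : linear g) (z3 : 1 + z + z ^+ 2 = 0).
Hypothesis g_ap : forall m w, g (ap \_(m) w) = z *: (ap \_(m) (g w)).
Hypothesis g_am : forall m w, g (am \_(m) w) = z ^+ 2 *: (am \_(m) (g w)).
Variable A : set W.
Hypothesis subA : vsubalgebra A.
Hypotheses (A_jj : A (weyl_jj ap am)) (A_omega : A (weyl_omega ap am)).
Hypotheses (A_cube : A (weyl_cube ap)) (A_cubeS : A (weyl_cube am)).

Lemma eigenspace_irreducible (N : set W) mu w :
  subspace N -> N `<=` [set v | g v = mu *: v] -> mu != 0 -> w != 0 -> N w ->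
  (forall a n v, A a -> N v -> N (a \_(n) v)) ->
  [set v | g v = mu *: v] `<=` N.
Proof.
move=> sN Nmu mu0 w0 Nw hN.
have pairs (Q : set W) : subspace Q -> (forall a n v, A a -> Q v -> Q (a \_(n) v)) ->
    forall m n v, Q v -> Q (ap \_(m) (am \_(n) v)).
  move=> sQ hQ m n v Qv; apply: (assoc_span sQ) => i j; apply: hQ => //.
  exact: (subalgebra_quadratic rel subA).
have [sA _ Amul] := subA.
have A_pairs := pairs A sA (fun a n v Aa Av => Amul a v n Aa Av).
(* The stability under pairs in the form required by [cubic_of_pairs] for the swapped generators a-
   and -a+. *)
have A_pairsS m n v : A v -> A (am \_(m) ((- ap) \_(n) v)).
  move=> Av; rewrite vmulNl vmulNr (am_ap rel) opprB.
  apply: (subspaceB sA); last exact: A_pairs.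
  by case: ifP => // _; exact: subspace0.
apply: (weyl_eigenspace_minimal rel gen ling z3 g_ap g_am sN Nmu mu0 w0 Nw).
- exact: pairs.
- apply: (cubic_stable sN) => l m k v Nv; apply: hN => //.
  exact: (cubic_of_pairs rel).
- apply: (cubic_stable sN) => l m k v Nv; apply: hN => //.
  exact: (cubic_of_pairs (weyl_swap rel)).
Qed.

End SubalgebraModules.

(** * Highest weight vectors a+ and a- *)

Section HighestWeightVectors.
Variables (F : numFieldType) (W : vertexAlgebra F) (ap am : W).
Hypothesis rel : weyl_relations ap am.

(** The shift in G^-(n) = G^-_(n+1) turns the condition on G^-(n-1) into one on mode n, as for
    G+. *)
Lemma weyl_bp_ap :
  [/\ bpJ (weyl_bp ap am) \_(0) ap = (1 / 3) *: ap,
      bpT (weyl_bp ap am) \_(1) ap = (1 / 2) *: ap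
    & forall n : int, 1 <= n ->
       [/\ bpJ (weyl_bp ap am) \_(n) ap = 0, bpT (weyl_bp ap am) \_(n + 1) ap = 0,
           bpGp (weyl_bp ap am) \_(n) ap = 0 & bpGm (weyl_bp ap am) \_(n) ap = 0]].
Proof.
rewrite (weyl_bpE ap am) /= scale1r; have apE : ap = ap \_(Negz 0) vac by rewrite vmul_vacN1.
split.
- by rewrite vmulZl [X in _ \_(_) X]apE; weyl_eval rel; rewrite -apE; lincomb F W.
- by rewrite [X in _ \_(_) X]apE; weyl_eval rel; rewrite -apE; lincomb F W.
case=> [[|n]|n] // _; split.
- by rewrite vmulZl [X in _ \_(_) X]apE; weyl_eval rel; lincomb F W.
- rewrite (_ : n.+1%:Z + 1 = n.+2%:Z); last by lia.
  by rewrite [X in _ \_(_) X]apE; weyl_eval rel; lincomb F W.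
- by rewrite vmulZl [X in _ \_(_) X]apE; weyl_eval rel; lincomb F W.
(* Writing a+ as -(-a+) exposes the second generator of the swapped pair. *)
- rewrite vmulZl [X in _ \_(_) X]apE -[X in _ \_(_) (X \_(_) _)]opprK vmulNl vmulNr.
  by rewrite (cube_am (weyl_swap rel)); weyl_eval rel; lincomb F W.
Qed.

Lemma weyl_bp_am :
  [/\ bpJ (weyl_bp ap am) \_(0) am = - (1 / 3) *: am,
      bpT (weyl_bp ap am) \_(1) am = (1 / 2) *: am
    & forall n : int, 1 <= n ->
       [/\ bpJ (weyl_bp ap am) \_(n) am = 0, bpT (weyl_bp ap am) \_(n + 1) am = 0,
           bpGp (weyl_bp ap am) \_(n) am = 0 & bpGm (weyl_bp ap am) \_(n) am = 0]].
Proof.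
rewrite (weyl_bpE ap am) /= scale1r; have amE : am = am \_(Negz 0) vac by rewrite vmul_vacN1.
split.
- by rewrite vmulZl [X in _ \_(_) X]amE; weyl_eval rel; rewrite -amE; lincomb F W.
- by rewrite [X in _ \_(_) X]amE; weyl_eval rel; rewrite -amE; lincomb F W.
case=> [[|n]|n] // _; split.
- by rewrite vmulZl [X in _ \_(_) X]amE; weyl_eval rel; lincomb F W.
- rewrite (_ : n.+1%:Z + 1 = n.+2%:Z); last by lia.
  by rewrite [X in _ \_(_) X]amE; weyl_eval rel; lincomb F W.
- by rewrite vmulZl [X in _ \_(_) X]amE; weyl_eval rel; lincomb F W.
- rewrite vmulZl [X in _ \_(_) X]amE (cube_ap (weyl_swap rel)).
  by weyl_eval rel; lincomb F W.
Qed.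

End HighestWeightVectors.

(** * The cube root of unity and the automorphism of order 3 *)

Section CubeRoot.
Variable R : realType.

Lemma two_pi_i_real (c : R) : two_pi_i R * c%:C = 0 +i* (2 * pi * c).
Proof. by apply/eqP; rewrite eq_complex /= !mulr0 !mul0r subr0 add0r !eqxx. Qed.

Definition zeta3 : R[i] := cexp (two_pi_i R / 3).

Lemma zeta3_cube : zeta3 * zeta3 ^+ 2 = 1.
Proof. rewrite /zeta3 expr2 -!cexpD -[RHS]cexp_two_pi_i; congr cexp; by field. Qed.

(** Its imaginary part is the sine of 2 pi/3, which lies strictly between 0 and pi. *)
Lemma zeta3_neq1 : zeta3 != 1.
Proof.
have e3 : (3^-1 : R[i]) = (3^-1 : R)%:C by rewrite fmorphV rmorph_nat.
rewrite /zeta3 e3 two_pi_i_real /cexp expR0 !mul1r eq_complex /= negb_and.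
apply/orP; right; rewrite gt_eqF // sin_gt0_pi //.
by have p0 := @pi_gt0 R; apply/andP; split; lra.
Qed.

Lemma zeta3_sum : 1 + zeta3 + zeta3 ^+ 2 = 0.
Proof.
have : (1 + zeta3 + zeta3 ^+ 2) * (zeta3 - 1) = 0.
  have -> : (1 + zeta3 + zeta3 ^+ 2) * (zeta3 - 1) = zeta3 * zeta3 ^+ 2 - 1 by ring.
  by rewrite zeta3_cube subrr.
by move/eqP; rewrite mulf_eq0 subr_eq0 (negbTE zeta3_neq1) orbF => /eqP.
Qed.

Lemma zeta3_neq0 : zeta3 != 0.
Proof.
by apply/eqP => e; have := zeta3_cube; rewrite e mul0r => /esym/eqP; rewrite oner_eq0.
Qed.

Variables (M : lmodType R[i]) (g : M -> M).

Lemma cube_eigenspace0 : cube_eigenspace g 0 = [set v | g v = v].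
Proof.
have e : cexp (two_pi_i R * 0%:~R / 3) = 1 by rewrite mulr0z mulr0 mul0r cexp0.
by apply/seteqP; split=> v; rewrite /cube_eigenspace /mkset e scale1r.
Qed.

Lemma cube_eigenspace1 : cube_eigenspace g 1 = [set v | g v = zeta3 *: v].
Proof. by apply/seteqP; split=> v; rewrite /cube_eigenspace /mkset mulr1. Qed.

Lemma cube_eigenspaceN1 : cube_eigenspace g (-1) = [set v | g v = zeta3 ^+ 2 *: v].
Proof.
have e : cexp (two_pi_i R * (-1)%:~R / 3) = zeta3 ^+ 2.
  apply: (mulfI zeta3_neq0); rewrite zeta3_cube -cexpD -[RHS]cexp0; congr cexp.
  by rewrite mulrN1 mulNr subrr.
by apply/seteqP; split=> v; rewrite /cube_eigenspace /mkset e.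
Qed.

End CubeRoot.

Section WeylAutomorphism.
Variables (R : realType) (W : vertexAlgebra R[i]) (ap am : W).
Hypothesis rel : weyl_relations ap am.
Hypothesis gen : generated [set y | y = ap \/ y = am].

Let J := bpJ (weyl_bp ap am).
Let L : set R[i] := [set l | exists d : int, l = d%:~R / 3].

Definition weyl_aut : W -> W :=
  fcalc (vmul (bpJ (weyl_bp ap am)) 0) (fun l => cexp (two_pi_i R * l)).

Lemma weyl_charge_diagonalizable : diagonalizable (vmul J 0) L.
Proof.
apply: (zero_mode_diagonalizable _ _ gen).
- by exists 0; rewrite mul0r.
- by move=> _ _ [d ->] [e ->]; exists (d + e); rewrite rmorphD mulrDl.
- move=> _ [->|->].
    by have [h _ _] := weyl_bp_ap rel; exists (1 / 3) => //; exists 1.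
  by have [h _ _] := weyl_bp_am rel; exists (- (1 / 3)) => //; exists (-1); rewrite mulNr.
Qed.

Let dJ := weyl_charge_diagonalizable.
Let lJ : linear (vmul J 0). Proof. exact: vmul_linearr. Qed.

Lemma weyl_aut_linear : linear weyl_aut.
Proof. exact: (fcalc_linear lJ dJ). Qed.

Lemma weyl_aut_vac : weyl_aut vac = vac.
Proof. by apply: (fcalc_zero_mode_vac dJ); rewrite mulr0 cexp0. Qed.

Lemma weyl_aut_mul a n b : weyl_aut (a \_(n) b) = weyl_aut a \_(n) weyl_aut b.
Proof. by apply: (fcalc_zero_mode_mul dJ) => l m; rewrite mulrDr cexpD. Qed.

Lemma weyl_aut_ap : weyl_aut ap = zeta3 R *: ap.
Proof.
have [h _ _] := weyl_bp_ap rel; rewrite /weyl_aut (fcalc_eigen lJ dJ _ h).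
by rewrite mul1r.
Qed.

Lemma weyl_aut_am : weyl_aut am = zeta3 R ^+ 2 *: am.
Proof.
have [h _ _] := weyl_bp_am rel; rewrite /weyl_aut (fcalc_eigen lJ dJ _ h).
congr (_ *: _); apply: (mulfI (zeta3_neq0 R)); rewrite zeta3_cube -cexpD -[RHS]cexp0.
by congr cexp; rewrite mulrN mul1r subrr.
Qed.

(** The vectors fixed by the cube of an endomorphism form a subalgebra, so only the two generators
    need checking. *)
Lemma weyl_aut_cube v : weyl_aut (weyl_aut (weyl_aut v)) = v.
Proof.
move: v; apply: full_setP; apply: gen; last first.
  have gZ c x : weyl_aut (c *: x) = c *: weyl_aut x by exact: (lin_funZ weyl_aut_linear).
  have z3 := zeta3_cube R.
  move=> _ [->|->] /=.
    by rewrite !(weyl_aut_ap, gZ) !scalerA -mulrA -expr2 z3 scale1r.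
  rewrite !(weyl_aut_am, gZ) !scalerA.
  have -> : zeta3 R ^+ 2 * zeta3 R ^+ 2 * zeta3 R ^+ 2 = (zeta3 R * zeta3 R ^+ 2) ^+ 2 by ring.
  by rewrite z3 expr1n scale1r.
split.
- split=> [|c x y /= hx hy]; first by rewrite /= !(lin_fun0 weyl_aut_linear).
  by rewrite !weyl_aut_linear hx hy.
- by rewrite /= !weyl_aut_vac.
- by move=> a b n /= ha hb; rewrite !weyl_aut_mul ha hb.
Qed.

Lemma weyl_aut_automorphism : vautomorphism weyl_aut.
Proof.
split; last by exists (VHom weyl_aut_linear weyl_aut_vac weyl_aut_mul).
by exists (weyl_aut \o weyl_aut) => v; rewrite /= weyl_aut_cube.
Qed.

Lemma weyl_aut_op_exp : op_exp (fun v => two_pi_i R *: (J \_(0) v)) weyl_aut.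
Proof.
apply: (op_exp_of_eigen lJ weyl_aut_linear dJ) => l v [d ->] Jv.
exists (2 * pi * (d%:~R / 3)).
have e : two_pi_i R * (d%:~R / 3) = 0 +i* (2 * pi * (d%:~R / 3)).
  by rewrite -two_pi_i_real fmorph_div rmorph_int rmorph_nat.
by split=> //; rewrite -e /weyl_aut (fcalc_eigen lJ dJ _ Jv).
Qed.

Lemma weyl_aut_order (n : nat) : (0 < n < 3)%N -> iter n weyl_aut ap <> ap.
Proof.
have gZ c x : weyl_aut (c *: x) = c *: weyl_aut x by exact: (lin_funZ weyl_aut_linear).
have h (c : R[i]) : c != 1 -> c *: ap <> ap.
  move=> c1 e; have /eqP : (c - 1) *: ap = 0 by rewrite scalerBl scale1r e subrr.
  by rewrite scaler_eq0 subr_eq0 (negbTE c1) (negbTE (ap_neq0 rel)).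
case: n => [|[|[|n]]] // _ /=; rewrite weyl_aut_ap; first exact/h/zeta3_neq1.
(* If the square of [zeta3] were 1, its cube being 1 would force [zeta3] to be 1. *)
rewrite gZ weyl_aut_ap scalerA; apply: h; apply/eqP => e.
have := zeta3_cube R; rewrite expr2 e mulr1 => z1.
by have := zeta3_neq1 R; rewrite z1 eqxx.
Qed.

Let g_ap m w : weyl_aut (ap \_(m) w) = zeta3 R *: (ap \_(m) (weyl_aut w)).
Proof. by rewrite weyl_aut_mul weyl_aut_ap vmulZl. Qed.

Let g_am m w : weyl_aut (am \_(m) w) = zeta3 R ^+ 2 *: (am \_(m) (weyl_aut w)).
Proof. by rewrite weyl_aut_mul weyl_aut_am vmulZl. Qed.

Lemma weyl_aut_bp : bp_map weyl_aut (weyl_bp ap am) = weyl_bp ap am.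
Proof.
have gZ c x : weyl_aut (c *: x) = c *: weyl_aut x by exact: (lin_funZ weyl_aut_linear).
have gD x y : weyl_aut (x + y) = weyl_aut x + weyl_aut y.
  by have := weyl_aut_linear 1 x y; rewrite !scale1r.
have e1 : zeta3 R * zeta3 R ^+ 2 = 1 := zeta3_cube R.
have e3 : zeta3 R * (zeta3 R * zeta3 R) = 1 by rewrite -expr2.
rewrite /bp_map /weyl_bp /= !gZ gD -[- (_ \_(_) _)]scaleN1r gZ.
rewrite !(g_ap, g_am, weyl_aut_vac, vmulZr) !scalerA -!mulrA.
by rewrite !(e1, e3, mulr1) scale1r.
Qed.

Lemma weyl_aut_irreducible (A N : set W) mu w : vsubalgebra A ->
  A (weyl_jj ap am) -> A (weyl_omega ap am) -> A (weyl_cube ap) -> A (weyl_cube am) ->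
  subspace N -> N `<=` [set v | weyl_aut v = mu *: v] -> mu != 0 -> w != 0 -> N w ->
  (forall a n v, A a -> N v -> N (a \_(n) v)) ->
  [set v | weyl_aut v = mu *: v] `<=` N.
Proof.
move=> sA Ajj Ao Ac AcS sN Nmu mu0 w0 Nw hN.
exact: (eigenspace_irreducible rel gen weyl_aut_linear (zeta3_sum R) g_ap g_am
  sA Ajj Ao Ac AcS sN Nmu mu0 w0 Nw hN).
Qed.

End WeylAutomorphism.
(** * The simple quotient *)

Section UniversalBP.
Variables (F : numFieldType) (k : F) (V : vertexAlgebra F) (x : bp_fields V).
Hypothesis univ : is_universal_BP k x.

Lemma vcomm_1 (a b : V) n w : a \_(1) (b \_(n) w) =
  b \_(n) (a \_(1) w) + (a \_(0) b) \_(n + 1) w + (a \_(1) b) \_(n) w.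
Proof.
have [N hN] := vmul_trunc a b.
rewrite (vcomm (K := `|N|.+2)) => [|j hj]; last by apply: hN; lia.
rewrite !big_ord_recl /= binz0 binz1 !scale1r big1 => [|j _].
  rewrite addr0 addrA Posz0 addr0 (addrC 1 n).
  by rewrite (_ : n + 1 - (bump 0 0)%:Z = n) //; rewrite /bump /=; lia.
by rewrite /binz !big_ord_recl /= /bump /= subrr mul0r mulr0 mul0r scale0r.
Qed.

Lemma universal_BP_graded : pos_graded (vmul (bpT x) 1) vac.
Proof.
case: univ => + sg _; case: x sg => J T Gp Gm /= sg.
move=> [_ _ _ [TT [TGp TGm] TJ _]].
apply: (strongly_generated_graded _ _ sg); first exact: vmul_linearr.
  exact: vmul_vac_ge0.
move=> y Xy.
have [h hy0 hy1] : exists2 h : nat, T \_(0) y = vder y & T \_(1) y = (h.+1%:R / 2) *: y.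
  (* The number h + 1 is twice the conformal weight: 1 for J, 2 for T, 3/2 for G+ and G-. *)
  case: Xy => ->.
  - by exists 1%N; [exact: (TJ 0%N) | rewrite (TJ 1%N) /= divff ?scale1r ?pnatr_eq0].
  - exists 3%N; [exact: (TT 0%N) | rewrite (TT 1%N) /=; congr (_ *: _); by field].
  - by exists 2%N; [exact: (TGp 0%N) | exact: (TGp 1%N)].
  - by exists 2%N; [exact: (TGm 0%N) | exact: (TGm 1%N)].
exists h => n v; rewrite vcomm_1 hy0 hy1 vderl vmulZl addrK -addrA -scalerDl.
congr (_ + (_ + _) *: _).
by rewrite -rmorphN /= (_ : - (- n.+1%:Z + 1) = n%:Z) //; lia.
Qed.

End UniversalBP.

Section SimpleQuotient.
Variables (F : numFieldType) (V S U : vertexAlgebra F) (t : V).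
Hypothesis gradV : pos_graded (vmul t 1) (vac : V).
Variables (q : vhom V S) (phi : vhom V U).
Hypothesis simpleq : is_simple_quotient q.
(** Simplicity of the image of [phi], in the form of stable subspaces of the image that contain a
    nonzero vector. *)
Hypothesis irrphi : forall (N : set U) w, subspace N -> N `<=` range phi ->
  (forall a n v, N v -> N (phi a \_(n) v)) -> w != 0 -> N w -> N vac.

Lemma vhom_ker_subspace (T : vertexAlgebra F) (h : vhom V T) : subspace [set a | h a = 0].
Proof.
have lh := vhom_linear h; split=> [|c a b /= ha hb]; first exact: (lin_fun0 lh).
by rewrite lh ha hb scaler0 addr0.
Qed.

(* The grading makes the sum of two proper ideals of V a proper ideal. *)
Lemma kernels_proper a b : q a = 0 -> phi b = 0 -> vac <> a + b.
Proof.
move=> qa phib e.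
case: (pos_graded_split (@vmul_linearr F V t 1) gradV (vhom_ker_subspace q)
    (vhom_ker_subspace phi) _ _ qa phib e) => /=.
- by move=> u /= qu; rewrite vhom_vmul qu vmul0r.
- by move=> u /= pu; rewrite vhom_vmul pu vmul0r.
- by rewrite vhom_vac; apply/eqP/vac_neq0.
- by rewrite vhom_vac; apply/eqP/vac_neq0.
Qed.

Lemma simple_quotient_surj b : exists a, q a = b.
Proof.
have [rq _] := simpleq; have [a _ <-] : range q b by rewrite rq.
by exists a.
Qed.

(** Otherwise the image of ker q under [phi] would contain [vac] = [phi c] with [q c = 0], and [vac]
    = c + ([vac] - c) would be a sum of elements of the two kernels. *)
Lemma simple_quotient_ker_sub a : q a = 0 -> phi a = 0.
Proof.
move=> qa; apply/eqP/negPn/negP => pa0.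
have lq := vhom_linear q; have lphi := vhom_linear phi.
have [||||c qc phic] := irrphi (N := phi @` [set b | q b = 0]) _ _ _ pa0.
- split; first by exists 0; [exact: (lin_fun0 lq) | exact: (lin_fun0 lphi)].
  move=> c _ _ [b qb <-] [d qd <-]; exists (c *: b + d); last by rewrite lphi.
  exact: (subspace_lin (vhom_ker_subspace q)).
- by move=> _ [b _ <-]; exists b.
- move=> b n _ [d qd <-]; exists (b \_(n) d); last by rewrite vhom_vmul.
  by rewrite /= vhom_vmul qd vmul0r.
- by exists a.
apply: (kernels_proper qc (b := vac - c)); last by rewrite addrC subrK.
by rewrite addrC -scaleN1r lphi vhom_vac phic scaleN1r addNr.
Qed.

(** The image of ker phi under [q] is an ideal of a simple algebra; were it everything, [vac] would
    again split between the two kernels. *)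
Lemma simple_quotient_ker_sup a : phi a = 0 -> q a = 0.
Proof.
move=> phia; have lq := vhom_linear q; have lphi := vhom_linear phi.
have [_ simS] := simpleq; pose I := q @` [set b | phi b = 0].
have idI : videal I.
  split.
    split; first by exists 0; [exact: (lin_fun0 lphi) | exact: (lin_fun0 lq)].
    move=> c _ _ [b pb <-] [d pd <-]; exists (c *: b + d); last by rewrite lq.
    exact: (subspace_lin (vhom_ker_subspace phi)).
  move=> b _ n [d pd <-]; have [c <-] := simple_quotient_surj b.
  split; [exists (c \_(n) d) | exists (d \_(n) c)]; rewrite /= vhom_vmul ?pd //.
    by rewrite vmul0r.
  by rewrite vmul0l.
have [I0|/full_setP IT] := simS I idI.
  by have : I (q a) by [exists a]; rewrite I0.
have [c pc qc] := IT vac; exfalso.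
apply: (kernels_proper (a := vac - c) _ pc); last by rewrite subrK.
by rewrite addrC -scaleN1r lq vhom_vac qc scaleN1r addNr.
Qed.

Lemma simple_quotient_factor :
  exists psi : vhom S U, injective psi /\ forall v, psi (q v) = phi v.
Proof.
have lq := vhom_linear q; have lphi := vhom_linear phi.
(* The embedding is [phi] composed with a chosen section of [q]; equality of the kernels makes it
   independent of the choice and injective. *)
pose s b := sval (cid (simple_quotient_surj b)).
have qs b : q (s b) = b by rewrite /s; case: cid.
have wd a b : q a = q b -> phi a = phi b.
  move=> e; apply/eqP; rewrite -subr_eq0 addrC -scaleN1r -lphi.
  apply/eqP/simple_quotient_ker_sub.
  by rewrite lq e scaleN1r addNr.
have h1 : linear (phi \o s).
  by move=> c a b /=; rewrite -lphi; apply: wd; rewrite lq !qs.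
have h2 : (phi \o s) vac = vac.
  by rewrite /= -(vhom_vac phi); apply: wd; rewrite qs vhom_vac.
have h3 a n b : (phi \o s) (a \_(n) b) = (phi \o s) a \_(n) (phi \o s) b.
  by rewrite /= -vhom_vmul; apply: wd; rewrite vhom_vmul !qs.
exists (VHom h1 h2 h3); split=> [a b /= e|v /=]; last by apply: wd; rewrite qs.
rewrite -[a]qs -[b]qs; apply/eqP; rewrite -subr_eq0 addrC -scaleN1r -lq.
apply/eqP/simple_quotient_ker_sup.
by rewrite lphi e scaleN1r addNr.
Qed.

End SimpleQuotient.

(** * The image of the universal algebra and its modules *)

Section BPModules.
Variables (R : realType) (V S W : vertexAlgebra R[i]) (x : bp_fields V) (q : vhom V S).
Variables ap am : W.
Hypothesis univ : is_universal_BP (- (5 / 3)) x.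
Hypothesis simpleq : is_simple_quotient q.
Hypothesis rel : weyl_relations ap am.
Hypothesis gen : generated [set y | y = ap \/ y = am].
Variable phi : vhom V W.
Hypothesis phiE : bp_map phi x = weyl_bp ap am.

Local Notation g := (weyl_aut ap am).

Lemma bp_image_fixed a : g (phi a) = phi a.
Proof.
have lg := weyl_aut_linear rel gen; have lphi := vhom_linear phi.
have [_ sg _] := univ; have gE := weyl_aut_bp rel gen; rewrite -phiE in gE.
have [gJ gT gGp gGm] := gE.
move: a; apply: full_setP; apply: sg => [||y n v Xy /= hv].
- by split=> [|c a b /= ha hb]; rewrite ?(lin_fun0 lphi) ?(lin_fun0 lg) // lphi lg ha hb.
- by rewrite vhom_vac (weyl_aut_vac rel gen).
- by rewrite vhom_vmul (weyl_aut_mul rel gen) hv; case: Xy => ->; congr vmul.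
Qed.

Lemma bp_image_subalgebra : vsubalgebra (range phi).
Proof.
have lphi := vhom_linear phi; split.
- split; first by exists 0 => //; exact: (lin_fun0 lphi).
  by move=> c _ _ [a _ <-] [b _ <-]; exists (c *: a + b); rewrite ?lphi.
- by exists vac => //; exact: vhom_vac.
- by move=> _ _ n [a _ <-] [b _ <-]; exists (a \_(n) b) => //; exact: vhom_vmul.
Qed.

Lemma bp_image_irreducible (N : set W) mu w : subspace N ->
  N `<=` [set v | g v = mu *: v] -> mu != 0 -> w != 0 -> N w ->
  (forall a n v, N v -> N (phi a \_(n) v)) -> [set v | g v = mu *: v] `<=` N.
Proof.
move=> sN Nmu mu0 w0 Nw hN; have := phiE; rewrite weyl_bpE scale1r => -[eJ eT eP eM].
have [sA _ _] := bp_image_subalgebra.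
apply: (weyl_aut_irreducible rel gen bp_image_subalgebra _ _ _ _ sN Nmu mu0 w0 Nw).
- apply: (subspaceZK sA (c := - (1 / 3))).
    by rewrite oppr_eq0 mul1r invr_eq0 pnatr_eq0.
  by rewrite -eJ; exists (bpJ x).
- by rewrite -eT; exists (bpT x).
- apply: (subspaceZK sA (c := 1 / 3)); first by rewrite mul1r invr_eq0 pnatr_eq0.
  by rewrite -eP; exists (bpGp x).
- apply: (subspaceZK sA (c := 1 / 9)); first by rewrite mul1r invr_eq0 pnatr_eq0.
  by rewrite -eM; exists (bpGm x).
- by move=> _ n v [a _ <-]; exact: hN.
Qed.

(** Minimality of eigenspaces is applied to the image itself, which contains [vac] and consists of
    vectors fixed by g. *)
Lemma bp_image : range phi = [set v | g v = v].
Proof.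
have e1 : [set v | g v = v] = [set v | g v = 1 *: v].
  by apply/seteqP; split=> v /=; rewrite scale1r.
have [sA Avac Amul] := bp_image_subalgebra.
apply/seteqP; split=> [_ [a _ <-]|]; first exact: bp_image_fixed.
rewrite e1; apply: (bp_image_irreducible sA _ (oner_neq0 _) (vac_neq0 W) Avac).
  by move=> _ [a _ <-] /=; rewrite scale1r bp_image_fixed.
by move=> a n v Av; apply: Amul => //; exists a.
Qed.

Lemma bp_simple_embedding :
  exists psi : vhom S W, injective psi /\ forall v, psi (q v) = phi v.
Proof.
apply: (simple_quotient_factor (universal_BP_graded univ) simpleq) => N w sN Nphi hN w0 Nw.
suff h : [set v | g v = 1 *: v] `<=` N by apply: h; rewrite /= scale1r (weyl_aut_vac rel gen).
apply: (bp_image_irreducible sN _ (oner_neq0 _) w0 Nw hN) => v /Nphi [a _ <-] /=.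
by rewrite scale1r bp_image_fixed.
Qed.

Variable psi : vhom S W.
Hypothesis psiE : forall v, psi (q v) = phi v.

Lemma eigenspace_virreducible mu v0 : mu != 0 -> v0 != 0 -> g v0 = mu *: v0 ->
  [/\ @virreducible _ _ (vrestrict psi (vadjoint W)) [set v | g v = mu *: v]
    & forall N' : set W, @vsubmodule _ _ (vrestrict psi (vadjoint W)) N' -> N' v0 ->
        [set v | g v = mu *: v] `<=` N'].
Proof.
move=> mu0 v00 gv0; have lg := weyl_aut_linear rel gen.
have sE := eigenspace_subspace lg mu.
have subE : @vsubmodule _ _ (vrestrict psi (vadjoint W)) [set v | g v = mu *: v].
  split=> // b n w /= gw; have [a <-] := simple_quotient_surj simpleq b.
  by rewrite /= psiE (weyl_aut_mul rel gen) bp_image_fixed gw vmulZr.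
have act N' : @vsubmodule _ _ (vrestrict psi (vadjoint W)) N' ->
    forall a n v, N' v -> N' (phi a \_(n) v).
  by move=> [_ hN'] a n v N'v; have := hN' (q a) n v N'v; rewrite /= psiE.
split; first split=> //.
- by move=> e; have : [set v | g v = mu *: v] v0 by []; rewrite e => /eqP; rewrite (negbTE v00).
- move=> N' sN' N'E.
  have [h|/existsNP[w /not_implyP[N'w w0]]] := pselect (forall w, N' w -> w = 0).
    left; apply/seteqP; split=> [w /h //|_ ->]; exact: (subspace0 sN'.1).
  right; apply/seteqP; split=> //.
  apply: (bp_image_irreducible sN'.1 N'E mu0 _ N'w); first exact/eqP.
  exact: act.
- move=> N' sN' N'v0 w gw.
  (* A submodule containing [v0] may leave the eigenspace, so it is first intersected with it. *)
  have sI : subspace (N' `&` [set v | g v = mu *: v]).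
    split; first by split; [exact: (subspace0 sN'.1) | exact: (subspace0 sE)].
    by move=> c a b [Na ga] [Nb gb]; split; [exact: (subspace_lin sN'.1) | exact: (subspace_lin sE)].
  have [] // := bp_image_irreducible sI (@subIsetr _ _ _) mu0 v00 (conj N'v0 gv0) _ gw.
  move=> a n v [N'v gv]; split; first exact: act.
  by rewrite /= (weyl_aut_mul rel gen) bp_image_fixed gv vmulZr.
Qed.

End BPModules.

Unset Implicit Arguments.

Theorem proposition5p9 (R : realType) (Wuniv Wsimple W : vertexAlgebra R[i])
    (x : bp_fields Wuniv) (q : vhom Wuniv Wsimple) (ap am : W) :
  is_universal_BP (- (5 / 3)) x ->
  is_simple_quotient q ->
  is_weyl ap am ->
  exists g : W -> W,
    let W_ (j : int) : set W := cube_eigenspace g j in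
    [/\ op_exp (fun v => two_pi_i R *: (bpJ (weyl_bp ap am) \_(0) v)) g,
        vautomorphism g,
        (forall v, iter 3 g v = v)
          /\ (forall n : nat, (0 < n < 3)%N -> exists v, iter n g v <> v),
        direct_sum3 (W_ 0) (W_ 1) (W_ (-1))
      & exists (phi : vhom Wuniv W) (psi : vhom Wsimple W),
          let WM : vmodule Wsimple := vrestrict psi (vadjoint W) in
          [/\ bp_map phi x = weyl_bp ap am,
              range phi = W_ 0,
              [/\ injective psi, range psi = W_ 0 & forall v, psi (q v) = phi v],
              @virreducible _ _ WM (W_ 1)
                /\ @highest_weight _ _ (bp_map q x) WM (W_ 1) (1 / 3) (1 / 3)
            & @virreducible _ _ WM (W_ (-1))
                /\ @highest_weight _ _ (bp_map q x) WM (W_ (-1)) (- (1 / 3)) (2 / 3)]].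
Proof.
move=> univ simpq [rel gen _].
have lg := weyl_aut_linear rel gen.
have [_ _ U] := univ; have [phi phiE] := U _ _ (weyl_bp_relations rel).
have [psi [psi_inj psiE]] := bp_simple_embedding univ simpq rel gen phiE.
have rangeE := bp_image univ rel gen phiE.
have z0 := zeta3_neq0 R.
have bpE : bp_map psi (bp_map q x) = weyl_bp ap am.
  by rewrite -phiE /bp_map /= !psiE.
have [eJ eT eP eM] : [/\ psi (q (bpJ x)) = bpJ (weyl_bp ap am),
    psi (q (bpT x)) = bpT (weyl_bp ap am), psi (q (bpGp x)) = bpGp (weyl_bp ap am)
    & psi (q (bpGm x)) = bpGm (weyl_bp ap am)] by rewrite -bpE.
have am0 : am != 0 := ap_neq0 (weyl_swap rel).
exists (weyl_aut ap am) => W_.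
have E0 : W_ 0 = [set v | weyl_aut ap am v = v] := cube_eigenspace0 _.
have E1 : W_ 1 = [set v | weyl_aut ap am v = zeta3 R *: v] := cube_eigenspace1 _.
have EN1 : W_ (-1) = [set v | weyl_aut ap am v = zeta3 R ^+ 2 *: v] := cube_eigenspaceN1 _.
rewrite E0 E1 EN1; split.
- exact: weyl_aut_op_exp.
- exact: weyl_aut_automorphism.
- split=> [v|n n3]; first exact: weyl_aut_cube.
  by exists ap; exact: weyl_aut_order.
- exact: (direct_sum3_eigen lg (zeta3_sum R) (weyl_aut_cube rel gen)).
exists phi, psi => WM; split=> //.
- split=> //; rewrite -rangeE; apply/seteqP; split=> [_ [b _ <-]|_ [a _ <-]].
    by have [a <-] := simple_quotient_surj simpq b; exists a.
  by exists (q a).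
- have [irr hmin] := eigenspace_virreducible univ simpq rel gen phiE psiE z0
    (ap_neq0 rel) (weyl_aut_ap rel gen).
  split=> //; have [sub _ _] := irr; split=> //; exists ap.
  have [hJ hT hn] := weyl_bp_ap rel.
  rewrite /bpJn /bpLn /bpGpn /bpGmn /= eJ eT eP eM add0r; split=> //.
  + exact: weyl_aut_ap.
  (* L(0) is L_0 minus half of J_0, here 1/2 - 1/6 = 1/3. *)
  + by rewrite hT hJ mulr1z; lincomb R[i] W.
  + by move=> n /hn[-> -> -> hM]; rewrite subrK hM scaler0 subr0.
- have [irr hmin] := eigenspace_virreducible univ simpq rel gen phiE psiE (expf_neq0 2 z0)
    am0 (weyl_aut_am rel gen).
  split=> //; have [sub _ _] := irr; split=> //; exists am.
  have [hJ hT hn] := weyl_bp_am rel.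
  rewrite /bpJn /bpLn /bpGpn /bpGmn /= eJ eT eP eM add0r; split=> //.
  + exact: weyl_aut_am.
  (* Here the charge is -1/3, and 1/2 + 1/6 = 2/3. *)
  + by rewrite hT hJ mulr1z; lincomb R[i] W.
  + by move=> n /hn[-> -> -> hM]; rewrite subrK hM scaler0 subr0.
Qed.
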